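(* Let $n\in\mathbb{N}$, $k\geq2$, $u\equiv a_{i_1}a_{i_2}\cdots a_{i_k}$ and letters $x,y$, with $x,y,a_{i_1},\dots,a_{i_k}\in\{a_1,\dots,a_n\}$, and let $S=sgp^+\langle a_1,\dots,a_n\mid u=xy\rangle$, where $\{u=xy\}$ is a Gröbner–Shirshov basis. If $a_{i_{k-1}}a_{i_k}\not\equiv xy$ and $u\not\equiv y^{k-1}x$, then $S$ is automatic and $S^1$ is prefix-automatic.
   Context: $A^*$ is the free monoid (empty word $\varepsilon$), $A^+=A^*\setminus\{\varepsilon\}$, $\equiv$ is equality of words. $sgp^+\langle A\mid R\rangle$ is $A^+$ modulo the congruence generated by $R$. For $S=sgp^+\langle A\mid R\rangle$, $S^1=sgp^+\langle A\cup\{e\}\mid R,\ ea=ae=a\ (a\in A),\ ee=e\rangle$ ($e$ a new letter, the identity of $S^1$). Gröbner–Shirshov bases: fix a well-ordering of $A$ and the deg-lex ordering on $A^*$ (length, then lexicographic). For monic polynomials $f,g$ in the free associative algebra $F\langle A\rangle$ over a field with leading words $\bar f,\bar g$: if $w\equiv\bar f b\equiv a\bar g$ with $|\bar f|+|\bar g|>|w|$, $(f,g)_w=fb-ag$; if $w\equiv\bar f\equiv a\bar g b$, $(f,g)_w=f-agb$; trivial modulo $(R,w)$ if it equals $\sum\alpha_i a_i s_i b_i$ with $s_i\in R$, $a_i\bar{s_i}b_i<w$. $R$ is a Gröbner–Shirshov basis if all compositions are trivial; $\{u=xy\}$ is one if $\{u-xy\}$ is. Automaticity: regular = accepted by a finite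 automaton. With $\$\notin A$, $A(2,\$)=(A\cup\{\$\})^2\setminus\{(\$,\$)\}$; $(\alpha,\beta)\delta_A^R$ is the word over $A(2,\$)$ obtained by padding the shorter word on the right with $\$$'s and reading letter pairs. For a semigroup generated by finite $A$, $\phi:A^+\to S$ canonical, $L\subseteq A^+$ regular with $\phi(L)=S$, write $\alpha=\beta$ if $\phi(\alpha)=\phi(\beta)$ and $L_a^\$=\{(\alpha,\beta)\delta^R_A:\alpha,\beta\in L,\alpha a=\beta\}$ for $a\in A\cup\{\varepsilon\}$. $S$ is automatic if some such $(A,L)$ has all $L_a^\$$ regular; prefix-automatic if some such automatic structure also has $\{(\alpha,\beta)\delta_A^R:\alpha\in L,\beta\in\mathrm{Pref}(L),\alpha=\beta\}$ regular ($\mathrm{Pref}(L)$ = prefixes of words of $L$). *)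

(* Defs.v *)
From HB Require Import structures.
From mathcomp Require Import all_boot all_algebra.
From Stdlib Require Import Relations.
Set Implicit Arguments.
Unset Strict Implicit.
Unset Printing Implicit Defensive.
Import GRing.Theory.

(* Semigroup presentations sgp^+<X | R>: words over a finite alphabet X,
   relations R : seq (lhs, rhs).  Elements of the presented semigroup are
   nonempty words modulo the congruence generated by R.                   *)

Definition rel_step (X : finType) (R : seq (seq X * seq X)) (v w : seq X) : Prop :=
  exists (p q l r : seq X), (l, r) \in R /\ v = p ++ l ++ q /\ w = p ++ r ++ q.

(* the congruence on X^* generated by R (on X^+ it is the congruence of
   sgp^+<X|R>; the empty word is only congruent to itself since all
   relation sides used below are nonempty) *)
Definition cong (X : finType) (R : seq (seq X * seq X)) : relation (seq X) :=
  clos_refl_sym_trans (seq X) (rel_step R).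

Record DFA (Sigma : finType) := {
  dfa_state : finType;
  dfa_start : dfa_state;
  dfa_final : pred dfa_state;
  dfa_trans : dfa_state -> Sigma -> dfa_state }.

Definition dfa_accepts (Sigma : finType) (D : DFA Sigma) (w : seq Sigma) : bool :=
  @dfa_final Sigma D (foldl (@dfa_trans Sigma D) (@dfa_start Sigma D) w).

Definition regular (Sigma : finType) (L : seq Sigma -> Prop) : Prop :=
  exists D : DFA Sigma, forall w, dfa_accepts D w <-> L w.

(* padded pair (alpha,beta)delta^R : None plays the role of the padding
   symbol $. *)
Definition pad (B : Type) (a b : seq B) : seq (option B * option B) :=
  [seq (onth a i, onth b i) | i <- iota 0 (maxn (size a) (size b))].

(* Automatic structures.  A finite generating set is given by a finite type
   B and an injective (modulo the congruence) map psi assigning to each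
   generator a (nonempty) word over X representing it.  The canonical map
   phi : B^+ -> S is  alpha |-> flatten (map psi alpha). *)

Definition phiB (X B : Type) (psi : B -> seq X) (a : seq B) : seq X :=
  flatten (map psi a).

Definition word_of_opt (B : Type) (a : option B) : seq B :=
  if a is Some b then [:: b] else [::].

Definition aut_struct (X : finType) (R : seq (seq X * seq X))
    (B : finType) (psi : B -> seq X) (L : seq B -> Prop) : Prop :=
  (forall b, psi b != [::]) /\
      (forall b c, cong R (psi b) (psi c) -> b = c) /\
      (forall al, L al -> al != [::]) /\
      regular L /\
      (forall w : seq X, w != [::] -> exists al, L al /\ cong R w (phiB psi al)) /\
      (forall a : option B,
         regular (fun z : seq (option B * option B) =>
            exists al be, [/\ L al, L be,
               cong R (phiB psi (al ++ word_of_opt a)) (phiB psi be) &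
               z = pad al be])).

Definition automatic (X : finType) (R : seq (seq X * seq X)) : Prop :=
  exists (B : finType) (psi : B -> seq X) (L : seq B -> Prop), aut_struct R psi L.

Definition prefix_automatic (X : finType) (R : seq (seq X * seq X)) : Prop :=
  exists (B : finType) (psi : B -> seq X) (L : seq B -> Prop),
    aut_struct R psi L /\
    regular (fun z : seq (option B * option B) =>
       exists al be, [/\ L al, (exists ga, L (be ++ ga)),
          cong R (phiB psi al) (phiB psi be) & z = pad al be]).

(* S^1 = sgp^+<A + {e} | R, ea = ae = a (a in A), ee = e>, with e = None *)
Definition adjoin_one_rels (n : nat) (R : seq (seq 'I_n * seq 'I_n))
    : seq (seq (option 'I_n) * seq (option 'I_n)) :=
  [seq (map Some r.1, map Some r.2) | r <- R] ++
  flatten [seq [:: ([:: None; Some a], [:: Some a]); ([:: Some a; None], [:: Some a])]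
          | a <- enum 'I_n] ++
  [:: ([:: None; None], [:: None])].

Fixpoint lexlt (n : nat) (v w : seq 'I_n) : bool :=
  match v, w with
  | a :: v', b :: w' => (nat_of_ord a < nat_of_ord b)%N || ((a == b) && lexlt v' w')
  | [::], _ :: _ => true
  | _, _ => false
  end.

Definition deglex_lt (n : nat) (v w : seq 'I_n) : bool :=
  (size v < size w)%N || ((size v == size w) && lexlt v w).

(* polynomials of F<A> as finite formal linear combinations of words *)
Definition fpoly (F : fieldType) (n : nat) := seq (F * seq 'I_n).

Definition pcoef (F : fieldType) (n : nat) (p : fpoly F n) (w : seq 'I_n) : F :=
  (\sum_(t <- p) (if t.2 == w then t.1 else 0))%R.

Definition peq (F : fieldType) (n : nat) (p q : fpoly F n) : Prop :=
  forall w, pcoef p w = pcoef q w.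

Definition pmulw (F : fieldType) (n : nat) (a : seq 'I_n) (p : fpoly F n) (b : seq 'I_n)
  : fpoly F n := [seq (t.1, a ++ t.2 ++ b) | t <- p].

Definition pscale (F : fieldType) (n : nat) (c : F) (p : fpoly F n) : fpoly F n :=
  [seq ((c * t.1)%R, t.2) | t <- p].

Definition psub (F : fieldType) (n : nat) (p q : fpoly F n) : fpoly F n :=
  p ++ pscale (-1)%R q.

(* a monic binomial is stored as (leading word, other word), with
   other < leading; its polynomial is  lead - other. *)
Definition bpoly (F : fieldType) (n : nat) (s : seq 'I_n * seq 'I_n) : fpoly F n :=
  [:: (1%R, s.1); ((-1)%R, s.2)].

Definition orient (n : nat) (l r : seq 'I_n) : seq 'I_n * seq 'I_n :=
  if deglex_lt r l then (l, r) else (r, l).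

Definition gs_trivial (F : fieldType) (n : nat) (R : seq (seq 'I_n * seq 'I_n))
    (h : fpoly F n) (w : seq 'I_n) : Prop :=
  exists ts : seq (F * seq 'I_n * (seq 'I_n * seq 'I_n) * seq 'I_n),
    (forall t, t \in ts -> (t.1.2 \in R) && deglex_lt (t.1.1.2 ++ t.1.2.1 ++ t.2) w) /\
    peq h (flatten [seq pscale t.1.1.1 (pmulw t.1.1.2 (bpoly F t.1.2) t.2) | t <- ts]).

Definition GS_basis (F : fieldType) (n : nat) (R : seq (seq 'I_n * seq 'I_n)) : Prop :=
  forall f g, f \in R -> g \in R ->
    (forall a b w : seq 'I_n, w = f.1 ++ b -> w = a ++ g.1 ->
       (size w < size f.1 + size g.1)%N ->
       gs_trivial R (psub (pmulw [::] (bpoly F f) b) (pmulw a (bpoly F g) [::])) w) /\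
    (forall a b : seq 'I_n, f.1 = a ++ g.1 ++ b ->
       gs_trivial R (psub (bpoly F f) (pmulw a (bpoly F g) b)) f.1).

(* Main.v *)
Require Import Defs.
From mathcomp Require Import all_boot all_algebra.
From mathcomp Require Import zify.
From Stdlib Require Import Relations Classical ClassicalEpsilon.
Set Implicit Arguments.
Unset Strict Implicit.
Unset Printing Implicit Defensive.

(* Orient the relation as [l -> xy].  The Groebner-Shirshov property makes the
   words avoiding [l] unique representatives.  Since [l] does not end in [xy],
   multiplying such a word on the right by a letter triggers at most one
   reduction, unless [l = d x]: then [w d^m x] reduces in cascade to [w x y^m].
   This is not synchronous when [|d| > 1].  If [d] starts with [x], the cascade
   stops after one step.  Otherwise [l] has no self-overlap, and a new generator
   standing for [d], together with the greedy parsing of words into copies of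
   [d], turns [d^m] into a block of length [m], up to bounded errors.  The tail
   [y^m] contains no copy of [d] because [d] is not a power of [y].  The language
   obtained is prefix-closed (up to the empty word), so for [S^1] the prefix
   relation is the diagonal. *)

(** * Regular languages and padded pairs *)

(** If [k = 2] and [xy] is the larger side, the same argument runs with the two sides exchanged: [l]
    is [xy], and [u] takes the place of the right-hand side. Multiplication is not described
    exactly. Since normal forms are unique, it suffices to exhibit a regular relation that is sound
    for the congruence and contains the normal form of each product. An automaton reads the common
    prefix without remembering it, so soundness has to be a congruence between the remaining
    suffixes alone. This is the difficulty with blocks: the greedy parse of [w d^m] need not break
    at the end of [w]. When [d] does not start with [x], the words [w d^m] and [w x y^m] differ just
    after [w], so a common prefix of their parses spells a prefix of [w] and can be cancelled. The
    automata are obtained classically from the finiteness of sets of bounded words. *)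

Section Regular.
Variable S : finType.
Implicit Types (L K : seq S -> Prop) (w : seq S).

Lemma regular_ext L K : (forall w, L w <-> K w) -> regular L -> regular K.
Proof. by move=> e [D HD]; exists D => w; rewrite HD. Qed.

Lemma regular_compl L : regular L -> regular (fun w => ~ L w).
Proof.
case=> D HD.
exists (Build_DFA (@dfa_start _ D) (fun q => ~~ @dfa_final _ D q) (@dfa_trans _ D)).
by move=> w; rewrite -HD; split=> [/negP|H]; last by apply/negP.
Qed.

Lemma regular_and L K : regular L -> regular K -> regular (fun w => L w /\ K w).
Proof.
move=> [D HD] [E HE].
exists (Build_DFA (dfa_start D, dfa_start E)
   (fun q => dfa_final q.1 && dfa_final q.2)
   (fun q a => (dfa_trans q.1 a, dfa_trans q.2 a))) => w.
have run v p q : foldl (fun t a => (@dfa_trans _ D t.1 a, @dfa_trans _ E t.2 a)) (p, q) v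
       = (foldl (@dfa_trans _ D) p v, foldl (@dfa_trans _ E) q v).
  by elim: v p q => //= a v IH p q; rewrite IH.
rewrite -HD -HE /dfa_accepts /= run /=; split=> [/andP|[-> ->]] //.
Qed.

Lemma regular_or L K : regular L -> regular K -> regular (fun w => L w \/ K w).
Proof.
move=> rL rK.
apply: regular_ext (regular_compl (regular_and (regular_compl rL) (regular_compl rK))).
by move=> w; split; have := classic (L w); tauto.
Qed.

Lemma regular_all (P : pred S) : regular (fun w => all P w).
Proof.
exists (Build_DFA true id (fun (s : bool) a => s && P a)) => w.
rewrite /dfa_accepts /=.
suff -> b : foldl (fun (s : bool) a => s && P a) b w = b && all P w by [].
by elim: w b => [|a w IH] b /=; rewrite ?andbT // IH andbA.
Qed.

Lemma regular_nil : regular (fun w => w = [::]).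
Proof. by apply: regular_ext (regular_all pred0) => -[|a w]; split. Qed.

Lemma regular_full : regular (fun w => True).
Proof. by apply: regular_ext (regular_all predT) => w; rewrite all_predT. Qed.

Lemma regular_empty : regular (fun w => False).
Proof. by apply: regular_ext (regular_compl regular_full) => w; split=> //; apply. Qed.

(** [Q] will be a congruence condition on fixed words; excluded middle chooses the automaton, so the
    congruence never has to be decided. *)
Lemma regular_guard (Q : Prop) L : regular L -> regular (fun w => Q /\ L w).
Proof.
move=> rL; have [q|nq] := classic Q; first by apply: regular_ext rL => w; tauto.
by apply: regular_ext regular_empty => w; tauto.
Qed.

Lemma regular_exists (I : finType) (L : I -> seq S -> Prop) :
  (forall i, regular (L i)) -> regular (fun w => exists i, L i w).
Proof.
move=> rL; suff: regular (fun w => exists2 i, i \in enum I & L i w).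
  apply: regular_ext => w; split=> [[i _ Li]|[i Li]]; exists i => //.
  by rewrite mem_enum.
elim: (enum I) => [|i s IH].
  by apply: regular_ext regular_empty => w; split=> // -[].
apply: regular_ext (regular_or (rL i) IH) => w; split.
  by case=> [Li|[j js Lj]]; [exists i; rewrite ?mem_head|exists j; rewrite ?inE ?js ?orbT].
by case=> j; rewrite inE => /orP[/eqP->|js] Lj; [left|right; exists j].
Qed.

Lemma regular_cons a L : regular L -> regular (fun w => exists2 v, w = a :: v & L v).
Proof.
case=> D HD.
(* [None] is the start, [Some None] the dead state, and [Some (Some q)] a run of [D] after the first
   letter. *)
pose tr (s : option (option (dfa_state D))) b :=
  match s with
  | None => if b == a then Some (Some (dfa_start D)) else Some None
  | Some None => Some None
  | Some (Some q) => Some (Some (dfa_trans q b))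
  end.
pose fin (s : option (option (dfa_state D))) :=
  if s is Some (Some q) then dfa_final q else false.
exists (Build_DFA None fin tr) => w.
have run v q : foldl tr (Some (Some q)) v = Some (Some (foldl (@dfa_trans _ D) q v)).
  by elim: v q => //= b v IH q; rewrite IH.
have dead v : foldl tr (Some None) v = Some None by elim: v.
rewrite /dfa_accepts /=; case: w => [|b w] /=; first by split=> // -[].
case: eqP => [->|nab]; last first.
  by rewrite dead; split=> // -[v [e _]]; case: nab.
rewrite run /=; split=> [/HD Lw|[v [<-] /HD]] //; by exists w.
Qed.

Lemma regular_word s : regular (fun w => w = s).
Proof.
elim: s => [|a s IH]; first exact: regular_nil.
apply: regular_ext (regular_cons a IH) => w.
by split=> [[v -> ->]|->] //; exists s.
Qed.

Lemma regular_quotient L s : regular L -> regular (fun w => L (w ++ s)).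
Proof.
case=> D HD.
exists (Build_DFA (dfa_start D) (fun q => dfa_final (foldl (@dfa_trans _ D) q s))
   (@dfa_trans _ D)) => w.
by rewrite -HD /dfa_accepts foldl_cat.
Qed.

(** Subset construction: beside the run of [D], the state records where [E] can be, one run being
    launched after every prefix that [D] accepts. *)
Lemma regular_cat L K : regular L -> regular K ->
  regular (fun w => exists v s, [/\ w = v ++ s, L v & K s]).
Proof.
move=> [D HD] [E HE].
pose add (q : dfa_state D) (T : {set dfa_state E}) :=
  if dfa_final q then dfa_start E |: T else T.
pose tr (p : dfa_state D * {set dfa_state E}) a :=
  let q := dfa_trans p.1 a in (q, add q [set dfa_trans t a | t in p.2]).
pose st := (dfa_start D, add (dfa_start D) set0).
exists (Build_DFA st (fun p => [exists t in p.2, dfa_final t]) tr) => w.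
have run v : (foldl tr st v).1 = foldl (@dfa_trans _ D) (dfa_start D) v /\
   forall t, t \in (foldl tr st v).2 <->
     exists v1 v2, [/\ v = v1 ++ v2, dfa_accepts D v1 &
                      t = foldl (@dfa_trans _ E) (dfa_start E) v2].
  elim/last_ind: v => [|v a [IH1 IH2]].
    split=> // t; rewrite /= /add.
    split.
      case: ifP => fD; rewrite ?inE // orbF => /eqP->.
      by exists [::], [::].
    case=> v1 [v2 [/esym/eqP]]; rewrite -size_eq0 size_cat addn_eq0 !size_eq0.
    by case/andP=> /eqP-> /eqP-> fD ->; rewrite [dfa_final _]fD !inE eqxx.
  rewrite !foldl_rcons /tr /= IH1; split=> // t; rewrite /add -foldl_rcons.
  have new : t \in [set dfa_trans t0 a | t0 in (foldl tr st v).2] <->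
     exists v1 v2, [/\ v = v1 ++ v2, dfa_accepts D v1 &
                      t = foldl (@dfa_trans _ E) (dfa_start E) (rcons v2 a)].
    split.
      case/imsetP=> q /IH2 [v1 [v2 [-> a1 ->]]] ->.
      by exists v1, v2; rewrite foldl_rcons.
    case=> v1 [v2 [e a1 ->]]; rewrite foldl_rcons; apply: imset_f; apply/IH2.
    by exists v1, v2.
  split.
    case: ifP => fD.
      rewrite !inE => /orP[/eqP->|/new[v1 [v2 [-> a1 ->]]]].
        by exists (rcons v a), [::]; rewrite cats0.
      by exists v1, (rcons v2 a); rewrite rcons_cat.
    by move=> /new[v1 [v2 [-> a1 ->]]]; exists v1, (rcons v2 a); rewrite rcons_cat.
  case=> v1 [v2]; case/lastP: v2 => [|v2 b].
    by rewrite cats0 => -[-> a1 ->]; rewrite [dfa_final _]a1 !inE eqxx.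
  rewrite -rcons_cat => -[/rcons_inj[e1 e2] a1 et].
  have tin : t \in [set dfa_trans t0 a | t0 in (foldl tr st v).2].
    by apply/new; exists v1, v2; rewrite e2.
  by case: ifP => _; rewrite ?inE tin ?orbT.
rewrite /dfa_accepts /=; split.
  case/existsP=> t /andP[/(proj2 (run w)) [v1 [v2 [-> a1 ->]]] ft].
  by exists v1, v2; split=> //; [apply/HD|apply/HE].
case=> v1 [v2 [-> /HD a1 /HE a2]]; apply/existsP.
exists (foldl (@dfa_trans _ E) (dfa_start E) v2); apply/andP; split=> //.
by apply/(proj2 (run _)); exists v1, v2.
Qed.

End Regular.

Lemma regular_premorph (S T : finType) (h : S -> seq T) (L : seq T -> Prop) :
  regular L -> regular (fun w => L (flatten (map h w))).
Proof.
case=> D HD.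
exists (Build_DFA (dfa_start D) (@dfa_final _ D)
   (fun q a => foldl (@dfa_trans _ D) q (h a))) => w.
rewrite -HD /dfa_accepts /=; move: (dfa_start D).
by elim: w => //= a w IH q; rewrite foldl_cat IH.
Qed.

Lemma regular_suffix (S : finType) (s : seq S) : regular (fun w => suffix s w).
Proof.
apply: regular_ext (regular_cat (regular_full S) (regular_word s)) => w.
split=> [[v [t [-> _ ->]]]|/suffixP[v ->]]; first exact: suffix_suffix.
by exists v, s.
Qed.

Lemma regular_infix (S : finType) (s : seq S) : regular (fun w => infix s w).
Proof.
apply: regular_ext (regular_cat (regular_suffix s) (regular_full S)) => w.
split.
  by case=> v [t [-> /suffixP[p ->] _]]; rewrite -catA; apply/infixP; exists p, t.
case/infixP=> p [t ->]; exists (p ++ s), t; split; rewrite ?catA //.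
exact: suffix_suffix.
Qed.

Section Pad.
Variable B : eqType.
Implicit Types al be g p q v r : seq B.

Lemma pad_cons a b al be : pad (a :: al) (b :: be) = (Some a, Some b) :: pad al be.
Proof. by rewrite /pad /= maxnSS /= -add1n iotaDl -map_comp. Qed.

Lemma pad0s be : pad [::] be = [seq (None, Some b) | b <- be].
Proof.
elim: be => //= b be <-; rewrite /pad /= !max0n /= -add1n iotaDl -map_comp.
by congr cons; apply: eq_map => -[].
Qed.

Lemma pads0 al : pad al [::] = [seq (Some a, None) | a <- al].
Proof.
elim: al => //= b be <-; rewrite /pad /= !maxn0 /= -add1n iotaDl -map_comp.
by congr cons; apply: eq_map => -[].
Qed.

Lemma pad_cat p q v r : size p = size q -> pad (p ++ v) (q ++ r) = pad p q ++ pad v r.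
Proof.
elim: p q => [|a p IH] [|b q] //= [e]; rewrite !pad_cons IH //.
Qed.

Lemma pad_nseq i (c y : B) : pad (nseq i c) (nseq i y) = nseq i (Some c, Some y).
Proof. by elim: i => //= i IH; rewrite pad_cons IH. Qed.

Definition diag_letter (z : option B * option B) := (z.1 == z.2) && (z.1 != None).

Lemma pad_diagP (z : seq (option B * option B)) :
  all diag_letter z <-> exists g, z = pad g g.
Proof.
split=> [|[g ->]]; last first.
  by elim: g => //= b g IH; rewrite pad_cons /= IH /diag_letter /= eqxx.
elim: z => [|[o o'] z IH] /=; first by exists [::].
case/andP=> /andP[/= /eqP<-]; case: o => // a _ /IH[g ->].
by exists (a :: g); rewrite pad_cons.
Qed.

Lemma pad_fst al be : flatten (map (fun z => word_of_opt z.1) (pad al be)) = al.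
Proof.
elim: al be => [|a al IH] be; first by rewrite pad0s; elim: be.
case: be => [|b be]; last by rewrite pad_cons /= IH.
by rewrite pads0 -map_comp; elim: (a :: al) => //= ? ? ->.
Qed.

Lemma pad_snd al be : flatten (map (fun z => word_of_opt z.2) (pad al be)) = be.
Proof.
elim: al be => [|a al IH] be; first by rewrite pad0s -map_comp; elim: be => //= ? ? ->.
case: be => [|b be]; last by rewrite pad_cons /= IH.
by rewrite pads0; elim: (a :: al).
Qed.

End Pad.

(** * Automatic structures from unique normal forms *)

Section Cong.
Variables (X : finType) (R : seq (seq X * seq X)).

Lemma cong_refl v : cong R v v. Proof. exact: rst_refl. Qed.

Lemma cong_sym v w : cong R v w -> cong R w v. Proof. exact: rst_sym. Qed.

Lemma cong_trans v w t : cong R v w -> cong R w t -> cong R v t.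
Proof. exact: rst_trans. Qed.

Lemma cong_ctx p q v w : cong R v w -> cong R (p ++ v ++ q) (p ++ w ++ q).
Proof.
elim=> {v w} [v w [p' [q' [l [r [lr [-> ->]]]]]]|v|v w _|v w t _ IH1 _ IH2].
- apply: rst_step; exists (p ++ p'), (q' ++ q), l, r; split=> //.
  by rewrite !catA.
- exact: cong_refl.
- exact: cong_sym.
- exact: cong_trans IH1 IH2.
Qed.

Lemma cong_rel l r : (l, r) \in R -> cong R l r.
Proof.
by move=> lr; apply: rst_step; exists [::], [::], l, r; rewrite /= !cats0.
Qed.

Lemma cong_nonempty v w :
  (forall s, s \in R -> s.1 != [::] /\ s.2 != [::]) ->
  cong R v w -> v = [::] <-> w = [::].
Proof.
move=> ne; elim=> {v w} [v w [p [q [l [r [lr [-> ->]]]]]]|v|v w _|v w t _ IH1 _ IH2]; try tauto.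
have [/= nl nr] := ne _ lr.
split=> /eqP; rewrite -!size_eq0 !size_cat !addn_eq0 !size_eq0.
  by rewrite (negPf nl) andbF.
by rewrite (negPf nr) andbF.
Qed.

End Cong.

(* The right multiplication [al * a = be] changes only a bounded suffix, or
   else turns a block [c^m] into [y^m] up to bounded suffixes; both shapes are
   recognised by a synchronous automaton. *)
Definition tail_mult (X B : finType) (E : relation (seq X)) (psi : B -> seq X)
    (c y : B) (K : nat) (a : B) (al be : seq B) : Prop :=
  (exists g v r, [/\ size v <= K, size r <= K, al = g ++ v, be = g ++ r &
     E (phiB psi (rcons v a)) (phiB psi r)]) \/
  (exists g p v q r m,
     [/\ [/\ size p <= K, size v <= K, size q <= K & size r <= K],
         size p = size q,
         al = g ++ p ++ nseq m c ++ v,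
         be = g ++ q ++ nseq m y ++ r &
         forall i, E (phiB psi (p ++ nseq i c ++ rcons v a))
                     (phiB psi (q ++ nseq i y ++ r))]).

(** The lengths of [p] and [q] differ by at most [K]. The shorter one absorbs that many copies of
    its repeated letter, and the copies left over on the other side join the tail. If [m <= K], the
    bounded shape applies, whence the factor 3. *)
Lemma tail_mult_unaligned (X B : finType) (E : relation (seq X)) (psi : B -> seq X)
    c y K a g p v q r m :
  size p <= K -> size v <= K -> size q <= K -> size r <= K ->
  (forall i, E (phiB psi (p ++ nseq i c ++ rcons v a)) (phiB psi (q ++ nseq i y ++ r))) ->
  tail_mult E psi c y (3 * K) a (g ++ p ++ nseq m c ++ v) (g ++ q ++ nseq m y ++ r).
Proof.
move=> sp sv sq sr h.
have bounded : m <= K -> tail_mult E psi c y (3 * K) a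
    (g ++ p ++ nseq m c ++ v) (g ++ q ++ nseq m y ++ r).
  move=> mK; left; exists g, (p ++ nseq m c ++ v), (q ++ nseq m y ++ r).
  by rewrite !rcons_cat !size_cat !size_nseq; split=> //; lia.
have [|mK] := leqP m K; first exact: bounded.
have dup j i (b : B) : nseq (j + i) b = nseq j b ++ nseq i b.
  by elim: j => //= j ->.
pose j := size q - size p; pose j' := size p - size q.
right; have [le|lt] := leqP (size p) (size q).
  exists g, (p ++ nseq j c), v, q, (nseq j y ++ r), (m - j).
  have em : m = j + (m - j) by rewrite /j; lia.
  have em' : m = m - j + j by lia.
  split.
  - by rewrite !size_cat !size_nseq /j; split; lia.
  - by rewrite !size_cat !size_nseq /j; lia.
  - by rewrite {1}em dup -!catA.
  - by rewrite {1}em' dup -!catA.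
  - by move=> i; have := h (j + i); rewrite {1}dup addnC dup -!catA.
exists g, p, (nseq j' c ++ v), (q ++ nseq j' y), r, (m - j').
have em : m = j' + (m - j') by rewrite /j'; lia.
have em' : m = m - j' + j' by lia.
split.
- by rewrite !size_cat !size_nseq /j'; split; lia.
- by rewrite !size_cat !size_nseq /j'; lia.
- by rewrite {1}em' dup -!catA.
- by rewrite {1}em dup -!catA.
- by move=> i; have := h (i + j'); rewrite {1}dup addnC dup rcons_cat -!catA.
Qed.

(** Exhibiting one product in [nf_mult] is enough because [nf_uniq] makes it the only one. [nf_pref]
    serves the prefix relation, and [nf_letter] the product of the adjoined identity with a
    generator. *)
Record nf_structure (X B : finType) (E : relation (seq X)) (psi : B -> seq X)
    (L : seq B -> Prop) (c y : B) (K : nat) : Prop := {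
  nf_psi : forall b, psi b != [::];
  nf_inj : forall b b', E (psi b) (psi b') -> b = b';
  nf_ne : forall al, L al -> al != [::];
  nf_reg : regular L;
  nf_surj : forall w, w != [::] -> exists al, L al /\ E w (phiB psi al);
  nf_uniq : forall al be, L al -> L be -> E (phiB psi al) (phiB psi be) -> al = be;
  nf_pref : forall be ga, L (be ++ ga) -> be != [::] -> L be;
  nf_letter : forall b, L [:: b];
  nf_mult : forall a al, L al -> exists be, L be /\ tail_mult E psi c y K a al be }.

Lemma phiB_cat (X B : Type) (psi : B -> seq X) s t :
  phiB psi (s ++ t) = phiB psi s ++ phiB psi t.
Proof. by rewrite /phiB map_cat flatten_cat. Qed.

Section Structure.
Variables (X B : finType) (R : seq (seq X * seq X)) (psi : B -> seq X).
Variables (L : seq B -> Prop) (c y : B) (K : nat).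
Hypothesis nfL : nf_structure (cong R) psi L c y K.

Let PB := (option B * option B)%type.

Lemma tail_mult_sound a al be : tail_mult (cong R) psi c y K a al be ->
  cong R (phiB psi (rcons al a)) (phiB psi be).
Proof.
case=> [[g [v [r [_ _ -> -> h]]]]|[g [p [v [q [r [m [_ _ -> -> h]]]]]]]].
  rewrite rcons_cat !phiB_cat -[X in cong _ X]cats0 -[X in cong _ _ X]cats0 -!catA.
  exact: cong_ctx.
rewrite !rcons_cat !(phiB_cat _ g) -[X in cong _ X]cats0 -[X in cong _ _ X]cats0 -!catA.
exact/cong_ctx/h.
Qed.

Lemma regular_diag : regular (fun z : seq PB => exists al, L al /\ z = pad al al).
Proof.
apply: regular_ext (regular_and (regular_all (@diag_letter B))
  (regular_premorph (fun z : PB => word_of_opt z.1) (nf_reg nfL))) => z; split.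
  by case=> /pad_diagP[g ->]; rewrite pad_fst => Lg; exists g.
by case=> al [Lal ->]; rewrite pad_fst; split=> //; apply/pad_diagP; exists al.
Qed.

(** The bounded words range over a finite type, and for each choice the congruence condition is a
    fixed proposition. There remains a concatenation of diagonal letters, fixed words and a run of
    [(c, y)]. The automaton does not count this run, which is why the second shape quantifies over
    all [i]. *)
Lemma regular_tail_mult a :
  regular (fun z : seq PB => exists al be, tail_mult (cong R) psi c y K a al be /\ z = pad al be).
Proof.
have r1 : regular (fun z : seq PB => exists v r : {bseq K of B},
    (cong R (phiB psi (rcons v a)) (phiB psi r)) /\
    exists z1 z2, [/\ z = z1 ++ z2, all (@diag_letter B) z1 & z2 = pad v r]).
  apply: regular_exists => v; apply: regular_exists => r; apply: regular_guard.
  apply: regular_cat; [exact: regular_all|exact: regular_word].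
have r2 : regular (fun z : seq PB => exists p v q r : {bseq K of B},
    (size p = size q /\ forall i, cong R (phiB psi (p ++ nseq i c ++ rcons v a))
                     (phiB psi (q ++ nseq i y ++ r))) /\
    exists z1 z2, [/\ z = z1 ++ z2, all (@diag_letter B) z1 &
    exists z3 z4, [/\ z2 = z3 ++ z4, z3 = pad p q &
    exists z5 z6, [/\ z4 = z5 ++ z6, all (pred1 (Some c, Some y)) z5 & z6 = pad v r]]]).
  do 4! apply: regular_exists => ?; apply: regular_guard.
  apply: regular_cat; first exact: regular_all.
  apply: regular_cat; first exact: regular_word.
  apply: regular_cat; [exact: regular_all|exact: regular_word].
apply: regular_ext (regular_or r1 r2) => z; split.
  case.
    case=> v [r [h [z1 [z2 [-> /pad_diagP[g ->] ->]]]]].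
    exists (g ++ v), (g ++ r); rewrite pad_cat //; split=> //; left.
    by exists g, v, r; split=> //; exact: size_bseq.
  case=> p [v [q [r [[spq h] [z1 [z2 [-> /pad_diagP[g ->] [z3 [z4 [-> ->]]]]]]]]]].
  case=> z5 [z6 [-> /all_pred1P e ->]]; move: (size z5) e => m ->.
  exists (g ++ p ++ nseq m c ++ v), (g ++ q ++ nseq m y ++ r); split.
    by right; exists g, p, v, q, r, m; split=> //; split; exact: size_bseq.
  by rewrite !pad_cat ?size_nseq // pad_nseq.
case=> al [be [h ->]]; case: h.
  case=> g [v [r [sv sr -> -> h]]]; left; exists (Bseq sv), (Bseq sr); split=> //.
  exists (pad g g), (pad v r); rewrite pad_cat //; split=> //.
  by apply/pad_diagP; exists g.
case=> g [p [v [q [r [m [[sp sv sq sr] spq -> -> h]]]]]]; right.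
exists (Bseq sp), (Bseq sv), (Bseq sq), (Bseq sr); split=> //.
exists (pad g g), (pad p q ++ nseq m (Some c, Some y) ++ pad v r).
rewrite !pad_cat ?size_nseq // pad_nseq; split=> //; first by apply/pad_diagP; exists g.
exists (pad p q), (nseq m (Some c, Some y) ++ pad v r); split=> //.
exists (nseq m (Some c, Some y)), (pad v r); split=> //.
by rewrite all_nseq /= eqxx orbT.
Qed.

Lemma nf_structure_aut : aut_struct R psi L.
Proof.
case: (nfL) => h1 h2 h3 h4 h5 h6 _ _ h8.
do 5! [split; first by []]; case=> [a|]; last first.
  apply: regular_ext regular_diag => z; split.
    by case=> al [Lal ->]; exists al, al; rewrite cats0; split=> //; exact: cong_refl.
  by case=> al [be [La Lb]]; rewrite cats0 => /h6-> // ->; exists be.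
apply: regular_ext (regular_and (regular_and
  (regular_premorph (fun z : PB => word_of_opt z.1) h4)
  (regular_premorph (fun z : PB => word_of_opt z.2) h4)) (regular_tail_mult a)) => z.
rewrite /= ; split.
  case=> [[L1 L2] [al [be [t ez]]]]; move: L1 L2; rewrite ez pad_fst pad_snd => L1 L2.
  by exists al, be; rewrite cats1; split=> //; exact: tail_mult_sound.
case=> al [be [La Lb]]; rewrite cats1 => e ->; rewrite pad_fst pad_snd; split=> //.
have [be' [Lb' t]] := h8 a _ La.
suff -> : be = be' by exists al, be'.
apply: h6 => //; apply: cong_trans (cong_sym e) _; exact: tail_mult_sound.
Qed.

Lemma nf_structure_prefix_aut :
  (forall s, s \in R -> s.1 != [::] /\ s.2 != [::]) -> prefix_automatic R.
Proof.
move=> ne; exists B, psi, L; split; first exact: nf_structure_aut.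
case: (nfL) => h1 _ h3 _ _ h6 h7 _ _.
apply: regular_ext regular_diag => z; split.
  case=> al [Lal ->]; exists al, al; split=> //; last exact: cong_refl.
  by exists [::]; rewrite cats0.
case=> al [be [La [ga Lbg] e ->]].
suff Lb : L be by rewrite -(h6 _ _ La Lb e); exists al.
(* The empty prefix is excluded because it is congruent only to itself. *)
apply: h7 Lbg _; apply/eqP => be0; move: e; rewrite be0 => /(cong_nonempty ne)[_ /(_ erefl)].
case: al La => [/h3 //|b al _] /=; rewrite /phiB /=.
by case: (psi b) (h1 b).
Qed.

End Structure.

(** * Adjoining an identity *)

Section AdjoinOne.
Variables (n : nat) (R : seq (seq 'I_n * seq 'I_n)).
Hypothesis neR : forall s, s \in R -> s.1 != [::] /\ s.2 != [::].
Let R1 := adjoin_one_rels R.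

Definition strip (T : Type) (w : seq (option T)) : seq T := pmap id w.

Lemma strip_cat (T : Type) (v w : seq (option T)) : strip (v ++ w) = strip v ++ strip w.
Proof. exact: pmap_cat. Qed.

Lemma strip_map (T : Type) (w : seq T) : strip (map Some w) = w.
Proof. by elim: w => //= a w IH; rewrite /strip /= -/(strip _) IH. Qed.

Lemma mem_adjoin_one s : s \in R1 ->
  [\/ exists2 t, t \in R & s = (map Some t.1, map Some t.2),
      exists a, s = ([:: None; Some a], [:: Some a]),
      exists a, s = ([:: Some a; None], [:: Some a]) |
      s = ([:: None; None], [:: None])].
Proof.
rewrite !mem_cat => /or3P[/mapP[t tR ->]|/flattenP[t /mapP[a _ ->]]|].
- by apply: Or41; exists t.
- by rewrite !inE => /orP[/eqP->|/eqP->]; [apply: Or42|apply: Or43]; exists a.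
- by rewrite inE => /eqP->; apply: Or44.
Qed.

Lemma adjoin_one_nonempty s : s \in R1 -> s.1 != [::] /\ s.2 != [::].
Proof.
case/mem_adjoin_one=> [[t /neR[t1 t2] ->]|[a ->]|[a ->]|->] //=.
by split; [case: t.1 t1|case: t.2 t2].
Qed.

Lemma cong_strip v w : cong R1 v w -> cong R (strip v) (strip w).
Proof.
elim=> {v w} [v w [p [q [l [r [lr [-> ->]]]]]]|v|v w _|v w t _ IH1 _ IH2].
- rewrite !strip_cat; case/mem_adjoin_one: lr => [[t tR [-> ->]]|[a [-> ->]]|[a [-> ->]]|[-> ->]].
  + by rewrite !strip_map; apply/cong_ctx/cong_rel; case: t tR.
  + exact: cong_refl.
  + exact: cong_refl.
  + exact: cong_refl.
- exact: cong_refl.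
- exact: cong_sym.
- exact: cong_trans IH1 IH2.
Qed.

Lemma cong_map_Some v w : cong R v w -> cong R1 (map Some v) (map Some w).
Proof.
elim=> {v w} [v w [p [q [l [r [lr [-> ->]]]]]]|v|v w _|v w t _ IH1 _ IH2].
- rewrite !map_cat; apply/cong_ctx/cong_rel; rewrite mem_cat; apply/orP; left.
  by apply/mapP; exists (l, r).
- exact: cong_refl.
- exact: cong_sym.
- exact: cong_trans IH1 IH2.
Qed.

Lemma cong_one_left a : cong R1 [:: None; Some a] [:: Some a].
Proof.
apply: cong_rel; rewrite !mem_cat; apply/orP; right; apply/orP; left.
apply/flattenP; exists [:: ([:: None; Some a], [:: Some a]); ([:: Some a; None], [:: Some a])].
  by apply/mapP; exists a; rewrite ?mem_enum.
exact: mem_head.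
Qed.

Lemma cong_one_right a : cong R1 [:: Some a; None] [:: Some a].
Proof.
apply: cong_rel; rewrite !mem_cat; apply/orP; right; apply/orP; left.
apply/flattenP; exists [:: ([:: None; Some a], [:: Some a]); ([:: Some a; None], [:: Some a])].
  by apply/mapP; exists a; rewrite ?mem_enum.
by rewrite !inE eqxx orbT.
Qed.

Lemma cong_one_one : cong R1 [:: None; None] [:: None].
Proof. by apply: cong_rel; rewrite !mem_cat mem_head !orbT. Qed.

Lemma cong_strip_map w : w != [::] ->
  cong R1 w (if strip w is [::] then [:: None] else map Some (strip w)).
Proof.
elim: w => //= o w IH _; case: w IH => [_|o' w IH].
  by case: o => [a|]; exact: cong_refl.
have {IH} := IH isT; move: (o' :: w) => {o'}w; rewrite /strip /= -/(strip w) => IH.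
have {IH} := cong_ctx [:: o] [::] IH; rewrite !cats0 => IH.
apply: cong_trans IH _; case: (strip w) => [|b s] /=; case: o => [a|] /=.
- exact: cong_one_right.
- exact: cong_one_one.
- exact: cong_refl.
- exact: (cong_ctx [::] (map Some s) (cong_one_left b)).
Qed.

(** With [cong_strip], this identifies equality in $S^1$ with congruence after erasing [e]. An empty
    erased word stands for [e] itself, and it can only match another empty one. *)
Lemma cong_adjoin_one v w : v != [::] -> w != [::] ->
  cong R (strip v) (strip w) -> cong R1 v w.
Proof.
move=> v0 w0 e; apply: cong_trans (cong_strip_map v0) _.
apply: cong_trans (cong_sym (cong_strip_map w0)).
have := cong_nonempty neR e; have := cong_map_Some e.
case: (strip v) => [|a s]; case: (strip w) => [|b t] // ? [h1 h2].
- exact: cong_refl.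
- by have := h1 erefl.
- by have := h2 erefl.
Qed.

Variables (B : finType) (psi : B -> seq 'I_n) (L : seq B -> Prop) (c y : B) (K : nat).
Hypothesis nfL : nf_structure (cong R) psi L c y K.

Definition psi1 (o : option B) := if o is Some b then map Some (psi b) else [:: None].

Lemma phiB_psi1_map al : phiB psi1 (map Some al) = map Some (phiB psi al).
Proof. by rewrite /phiB -map_comp map_flatten -map_comp. Qed.

Lemma strip_phiB_psi1 al : strip (phiB psi1 al) = phiB psi (strip al).
Proof.
elim: al => // o al IH; rewrite -cat1s phiB_cat !strip_cat IH phiB_cat.
by case: o => [b|] //; rewrite /phiB /= !cats0 strip_map.
Qed.

Definition lang1 (z : seq (option B)) := z = [:: None] \/ exists2 al, L al & z = map Some al.

(** The bound is raised to be positive: products involving [e] replace a suffix of length one. *)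
Lemma tail_mult_map a al be : tail_mult (cong R) psi c y K a al be ->
  tail_mult (cong R1) psi1 (Some c) (Some y) K.+1 (Some a) (map Some al) (map Some be).
Proof.
case=> [[g [v [r [sv sr -> -> h]]]]|[g [p [v [q [r [m [[sp sv sq sr] e -> -> h]]]]]]]].
  left; exists (map Some g), (map Some v), (map Some r).
  rewrite !map_cat !size_map !(leqW sv, leqW sr) -map_rcons !phiB_psi1_map; split=> //.
  exact: cong_map_Some.
right; exists (map Some g), (map Some p), (map Some v), (map Some q), (map Some r), m.
rewrite !map_cat !size_map !map_nseq !(leqW sv, leqW sr, leqW sp, leqW sq); split=> // i.
by rewrite -map_rcons -(map_nseq i Some c) -(map_nseq i Some y) -!map_cat !phiB_psi1_map; apply: cong_map_Some.
Qed.

Lemma nf_structure_adjoin_one :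
  nf_structure (cong R1) psi1 lang1 (Some c) (Some y) K.+1.
Proof.
case: (nfL) => h1 h2 h3 h4 h5 h6 h7 h8 h9.
have phi0 al : al != [::] -> phiB psi al != [::].
  by case: al => //= b al _; rewrite /phiB /=; case: (psi b) (h1 b).
have p1 b : psi1 b != [::] by case: b => //= b; case: (psi b) (h1 b).
split=> //.
- move=> [b|] [b'|] //= /cong_strip; rewrite ?strip_map.
  + by move/h2->.
  + by move/(cong_nonempty neR)=> [_ /(_ erefl) e]; move: (h1 b); rewrite e.
  + by move/(cong_nonempty neR)=> [/(_ erefl) e _]; move: (h1 b'); rewrite e.
- by move=> al [->|[s /h3 s0 ->]] //; case: s s0.
- apply: regular_ext (regular_or (regular_word [:: None]) (regular_and
    (regular_all isSome) (regular_premorph (@word_of_opt B) h4))) => z.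
  have aux (s : seq B) : flatten (map (@word_of_opt B) (map Some s)) = s.
    by elim: s => //= a s ->.
  split=> -[-> //|]; try by left.
    case=> az Lz; right; exists (flatten (map (@word_of_opt B) z)) => //.
    by elim: z az {Lz} => //= -[b|] z IH //= /IH {1}->.
  by case=> al La ->; right; rewrite aux; split=> //; apply/allP => o /mapP[b _ ->].
- move=> w w0; case e: (strip w) => [|a s].
    exists [:: None]; split; first by left.
    by apply: cong_adjoin_one => //; rewrite e; exact: cong_refl.
  have [|al [La ea]] := h5 (strip w); first by rewrite e.
  exists (map Some al); split; first by right; exists al.
  apply: cong_adjoin_one => //.
    by rewrite phiB_psi1_map; case: (phiB psi al) (phi0 _ (h3 _ La)).
  by rewrite strip_phiB_psi1 strip_map.
- move=> al be [->|[s Ls ->]] [->|[t Lt ->]] //= /cong_strip; rewrite !strip_phiB_psi1 ?strip_map.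
  + by move/(cong_nonempty neR)=> [/(_ erefl) e _]; move: (phi0 _ (h3 _ Lt)); rewrite e.
  + by move/(cong_nonempty neR)=> [_ /(_ erefl) e]; move: (phi0 _ (h3 _ Ls)); rewrite e.
  + by move/(h6 _ _ Ls Lt)->.
- move=> be ga [e|[s Ls e]] b0.
    by left; case: be b0 e => // b [|b' be] _ // [->].
  right; exists (take (size be) s).
    apply: (h7 _ (drop (size be) s)); rewrite ?cat_take_drop //.
    have : size be <= size s by rewrite -(size_map Some s) -e size_cat leq_addr.
    by move=> /size_takel; rewrite -!size_eq0 => ->; rewrite size_eq0.
  by rewrite map_take -e take_size_cat.
- by case=> [b|]; [right; exists [:: b]|left].
- case=> [b|] al; last first.
    move=> Lal; exists al; split=> //; left.
    have : al != [::] by case: Lal => [->|[s /h3 s0 ->]] //; case: s s0.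
    case/lastP: al {Lal} => // g o _; exists g, [:: o], [:: o].
    rewrite -cats1; split=> //; apply: cong_adjoin_one.
    + by rewrite /phiB /=; case: (psi1 o) (p1 o).
    + by rewrite /phiB /=; case: (psi1 o) (p1 o).
    + by rewrite !strip_phiB_psi1 /= /strip /=; case: o => *; exact: cong_refl.
  case=> [->|[s Ls ->]].
    exists [:: Some b]; split; first by right; exists [:: b].
    left; exists [::], [:: None], [:: Some b]; split=> //; apply: cong_adjoin_one => //.
      by rewrite /phiB /= cats0; case: (psi b) (h1 b).
    by rewrite !strip_phiB_psi1; exact: cong_refl.
  have [be [Lb /tail_mult_map t]] := h9 b _ Ls.
  by exists (map Some be); split=> //; right; exists be.
Qed.

End AdjoinOne.

(** * Unique normal forms from a Groebner-Shirshov basis *)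

Section Deglex.
Variable n : nat.
Implicit Types v w p q : seq 'I_n.

(* Words read as numerals in base [n + 1] with digits [1 .. n]: no digit is 0,
   so longer words have larger value and deglex becomes the order of [nat]. *)
Fixpoint rank w := if w is a :: w' then a.+1 * n.+1 ^ size w' + rank w' else 0.

Lemma rank_lt_exp w : rank w < n.+1 ^ size w.
Proof.
elim: w => //= a w IH; rewrite expnS.
have ha : a.+1 <= n by exact: ltn_ord.
have := leq_mul ha (leqnn (n.+1 ^ size w)); rewrite [n.+1 * _]mulSn; lia.
Qed.

Lemma rank_cat v w : rank (v ++ w) = rank v * n.+1 ^ size w + rank w.
Proof.
by elim: v => //= a v ->; rewrite size_cat expnD mulnDl addnA mulnA.
Qed.

Lemma deglex_size v w : deglex_lt v w -> size v <= size w.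
Proof. by case/orP=> [/ltnW //|/andP[/eqP-> _]]. Qed.

Lemma lexlt_rank v w : size v = size w -> lexlt v w -> rank v < rank w.
Proof.
elim: v w => [|a v IH] [|b w] //= [e] /orP[ab|/andP[/eqP<- /(IH _ e)]]; last first.
  by rewrite e ltn_add2l.
have := rank_lt_exp v; rewrite e => hv.
have := leq_mul ab (leqnn (n.+1 ^ size w)); rewrite mulSn; lia.
Qed.

Lemma deglex_rank v w : deglex_lt v w -> rank v < rank w.
Proof.
case/orP=> [h|/andP[/eqP e]]; last exact: lexlt_rank.
case: w h => //= a w; rewrite ltnS => h.
have := rank_lt_exp v; have := leq_pexp2l (ltn0Sn n) h.
rewrite mulSn; lia.
Qed.

Lemma rank_ctx p q v w : size v <= size w -> rank v < rank w ->
  rank (p ++ v ++ q) < rank (p ++ w ++ q).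
Proof.
move=> s h; rewrite !rank_cat !size_cat.
have e1 : rank p * n.+1 ^ (size v + size q) <= rank p * n.+1 ^ (size w + size q).
  by apply: leq_mul => //; apply: leq_pexp2l => //; rewrite leq_add2r.
have e2 : rank v * n.+1 ^ size q < rank w * n.+1 ^ size q.
  by rewrite ltn_pmul2r // expn_gt0.
lia.
Qed.

Lemma lexlt_total v w : size v = size w -> v != w -> lexlt v w || lexlt w v.
Proof.
elim: v w => [|a v IH] [|b w] //= [e]; rewrite eqseq_cons negb_and.
have [->|nab] := eqVneq a b; first by rewrite ltnn /=; apply: IH.
have : (a : nat) != b by apply: contra_neq nab => /val_inj.
by rewrite neq_ltn => /orP[->|->]; rewrite ?orbT.
Qed.

Lemma deglex_total v w : size v = size w -> v != w -> deglex_lt v w || deglex_lt w v.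
Proof.
by move=> e h; rewrite /deglex_lt e ltnn eqxx /=; apply: lexlt_total.
Qed.

End Deglex.

(** * Linear functionals and trivial compositions *)

Section Evaluation.
Import GRing.Theory.
Local Open Scope ring_scope.
Variables (F : fieldType) (n : nat).
Implicit Types (p q : fpoly F n) (K : pred (seq 'I_n)).

(** The linear functional on the free algebra whose value on words is the indicator of [K]. *)
Definition pev K p : F := \sum_(t <- p) (if K t.2 then t.1 else 0).

Lemma pev_support K p (U : seq (seq 'I_n)) : uniq U -> {subset map snd p <= U} ->
  pev K p = \sum_(w <- U) (if K w then pcoef p w else 0).
Proof.
move=> uU sU; rewrite /pev /pcoef.
transitivity (\sum_(w <- U) \sum_(t <- p) (if K w && (t.2 == w) then t.1 else 0)).
  rewrite exchange_big /= big_seq [RHS]big_seq; apply: eq_bigr => t tp.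
  have tU : t.2 \in U by apply: sU; apply: map_f.
  rewrite (bigD1_seq t.2) //= eqxx andbT big1 ?addr0 // => w wt.
  by rewrite eq_sym (negPf wt) andbF.
by apply: eq_bigr => w _; case: (K w) => //=; rewrite big1.
Qed.

Lemma pev_peq K p q : peq p q -> pev K p = pev K q.
Proof.
move=> e; pose U := undup (map snd (p ++ q)).
have uU : uniq U by exact: undup_uniq.
rewrite (@pev_support K p U) // ?(@pev_support K q U) //.
- by apply: eq_bigr => w _; rewrite e.
- by move=> w; rewrite mem_undup map_cat mem_cat => ->; rewrite orbT.
- by move=> w; rewrite mem_undup map_cat mem_cat => ->.
Qed.

Lemma pev_cat K p q : pev K (p ++ q) = pev K p + pev K q.
Proof. by rewrite /pev big_cat. Qed.

(* A congruence-closed set of words defines a linear functional which kills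
   every [a * (l - r) * b]; evaluating it on the composition shows that the
   two sides of the composition are in the same class. *)
Lemma gs_trivial_connected (l r a b w : seq 'I_n) :
  l ++ b = a ++ l ->
  gs_trivial [:: (l, r)]
    (psub (pmulw [::] (bpoly F (l, r)) b) (pmulw a (bpoly F (l, r)) [::])) w ->
  clos_refl_sym_trans _ (fun z z' => exists p q : seq 'I_n,
     [/\ z = p ++ l ++ q, z' = p ++ r ++ q & deglex_lt z w]) (r ++ b) (a ++ r).
Proof.
move=> e [ts [hts hp]]; set J := (X in clos_refl_sym_trans _ X).
pose K := fun z => if excluded_middle_informative (clos_refl_sym_trans _ J (r ++ b) z)
   then true else false.
have KP z : K z <-> clos_refl_sym_trans _ J (r ++ b) z.
  by rewrite /K; case: excluded_middle_informative.
apply/KP; have := pev_peq K hp.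
have -> : pev K (flatten [seq pscale t.1.1.1 (pmulw t.1.1.2 (bpoly F t.1.2) t.2) | t <- ts]) = 0.
  elim: ts hts {hp} => [|[[[al p] s] q] ts IH] hts; first by rewrite /pev big_nil.
  rewrite [X in pev K X](_ : _ = pscale al (pmulw p (bpoly F s) q) ++
    flatten [seq pscale t.1.1.1 (pmulw t.1.1.2 (bpoly F t.1.2) t.2) | t <- ts]) //.
  rewrite pev_cat IH ?addr0; last by move=> t tt; apply: hts; rewrite inE tt orbT.
  have /= := hts _ (mem_head _ _); rewrite inE => /andP[/eqP-> /=] lt.
  have step : J (p ++ l ++ q) (p ++ r ++ q) by exists p, q.
  have eK : K (p ++ l ++ q) = K (p ++ r ++ q).
    apply/idP/idP => /KP h; apply/KP; apply: rst_trans h _.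
      exact: rst_step.
    exact/rst_sym/rst_step.
  rewrite /pev /= !big_cons big_nil /= eK; case: (K _); last by rewrite !addr0.
  by rewrite mulr1 mulrN1 addr0 subrr.
have Kb : K (r ++ b) by apply/KP; exact: rst_refl.
(* The word [l ++ b = a ++ l] cancels, leaving the difference of [a ++ r] and [r ++ b]. Were
   [a ++ r] outside the class, the value would be [-1] instead of [0]. *)
rewrite /psub pev_cat /pev /= !big_cons !big_nil /= !cats0 e Kb !addr0.
case: (K (a ++ r)) => // /eqP; case: (K (a ++ l)).
  by rewrite mulr1 addr0 addrAC subrr add0r oppr_eq0 oner_eq0.
by rewrite !addr0 add0r oppr_eq0 oner_eq0.
Qed.

End Evaluation.

(** Levi's lemma in the free monoid. *)
Lemma cat_eq_split (T : eqType) (p p' s s' : seq T) : size p <= size p' ->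
  p ++ s = p' ++ s' -> exists2 t, p' = p ++ t & s = t ++ s'.
Proof.
move=> le e; exists (drop (size p) p').
  have := congr1 (take (size p)) e; rewrite take_size_cat // takel_cat // => {1}->.
  by rewrite cat_take_drop.
have := congr1 (drop (size p)) e; rewrite drop_size_cat // => ->.
rewrite drop_cat; case: ltnP => // h.
by have -> : size p = size p' by [lia]; rewrite subnn drop0 drop_size.
Qed.

(** * Confluence and uniqueness of normal forms *)

Section Confluence.
Variables (F : fieldType) (n : nat) (l r : seq 'I_n).
Hypothesis rl : deglex_lt r l.
Hypothesis gs : GS_basis F [:: (l, r)].
Implicit Types v w p q s t : seq 'I_n.

Let step := rel_step [:: (l, r)].

Definition irr w := ~~ infix l w.

Lemma stepP v w : step v w <-> exists p q, v = p ++ l ++ q /\ w = p ++ r ++ q.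
Proof.
split=> [[p [q [l' [r' []]]]]|[p [q [-> ->]]]].
  by rewrite inE => /eqP[-> ->] [-> ->]; exists p, q.
by exists p, q, l, r; rewrite inE eqxx.
Qed.

Lemma step_rank v w : step v w -> rank w < rank v.
Proof.
move=> /stepP[p [q [-> ->]]].
by apply: rank_ctx; [exact: deglex_size|exact: deglex_rank].
Qed.

Lemma irr_no_step v w : irr v -> ~ step v w.
Proof. by move=> /negP iv /stepP[p [q [e _]]]; apply: iv; apply/infixP; exists p, q. Qed.

Lemma not_irr_step v : ~~ irr v -> exists w, step v w.
Proof.
move/negPn/infixP=> [p [q ->]]; exists (p ++ r ++ q); apply/stepP; by exists p, q.
Qed.

(** Connectedness through words of rank below [N]: weaker than joinability, it is what a trivial
    composition provides directly. *)
Let below N := clos_refl_sym_trans (seq 'I_n) (fun z z' => step z z' /\ rank z < N).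

Lemma below_sym N v w : below N v w -> below N w v.
Proof. exact: rst_sym. Qed.

Lemma local_confluence p q p' q' : p ++ l ++ q = p' ++ l ++ q' ->
  below (rank (p ++ l ++ q)) (p ++ r ++ q) (p' ++ r ++ q').
Proof.
wlog le : p q p' q' / size p <= size p'.
  move=> H e; have [h|/ltnW h] := leqP (size p) (size p'); first exact: H.
  by rewrite e; apply/below_sym/H.
move=> e; have [a ep' e2] := cat_eq_split le e.
(* Disjoint occurrences of [l]: both results reduce to [p ++ r ++ b ++ r ++ q']. *)
have [la|la] := leqP (size l) (size a).
  have [b ea eq] := cat_eq_split la e2; rewrite ep' ea eq.
  apply: (rst_trans _ _ _ (p ++ r ++ b ++ r ++ q')).
    apply: rst_step; split.
      by apply/stepP; exists (p ++ r ++ b), q'; rewrite !catA.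
    by apply: rank_ctx; [exact: deglex_size|exact: deglex_rank].
  apply/rst_sym/rst_step; split.
    by apply/stepP; exists p, (b ++ r ++ q'); rewrite !catA.
  have := @rank_ctx _ (p ++ l ++ b) q' _ _ (deglex_size rl) (deglex_rank rl).
  by rewrite -!catA.
have [||b eb eq] := @cat_eq_split _ l (a ++ l) q q'.
- by rewrite size_cat leq_addl.
- by rewrite e2 catA.
have sab : size a = size b.
  by have := congr1 size eb; rewrite !size_cat; lia.
(* Overlapping occurrences: the composition on [l ++ b] yields a zigzag, which is then placed in the
   context [p], [q']. *)
have [h _] := gs (mem_head _ _) (mem_head _ _).
have {h} := h a b (l ++ b) erefl (esym eb).
rewrite /= size_cat -sab ltn_add2l => /(_ la)/(gs_trivial_connected (esym eb)).
move=> h; suff : below (rank (p ++ l ++ q)) (p ++ (r ++ b) ++ q') (p ++ (a ++ r) ++ q').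
  by rewrite ep' eq -!catA.
have -> : p ++ l ++ q = p ++ (l ++ b) ++ q' by rewrite eq -!catA.
elim: h => [z z' [p1 [q1 [-> -> lt]]]|z|z z' _|z z' z'' _ IH1 _ IH2].
- apply: rst_step; split; last by apply: rank_ctx; [exact: deglex_size|exact: deglex_rank].
  by apply/stepP; exists (p ++ p1), (q1 ++ q'); rewrite -!catA.
- exact: rst_refl.
- exact: rst_sym.
- exact: rst_trans IH1 IH2.
Qed.

Definition has_nf v s := clos_refl_trans _ step v s /\ irr s.

Lemma has_nf_irr v s : irr v -> has_nf v s -> s = v.
Proof.
move=> iv [/clos_rt_rt1n_iff h _]; case: h => // w t vw _.
by case: (irr_no_step iv vw).
Qed.

(** Newman's argument by induction on the rank: below [rank v] normal forms are unique, so connected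
    words there share theirs, and any two first steps from [v] lead to connected words. *)
Lemma unique_nf v : exists2 s, has_nf v s & forall t, has_nf v t -> t = s.
Proof.
have [N] := ubnP (rank v); elim: N v => // N IH v; rewrite ltnS => vN.
have [iv|] := boolP (irr v).
  exists v; first by split=> //; exact: rt_refl.
  by move=> t; exact: has_nf_irr.
move=> niv; have [w vw] := not_irr_step niv.
have [s [ws irs] us] := IH w (leq_trans (step_rank vw) vN).
have same z z' : below (rank v) z z' -> forall t, has_nf z t <-> has_nf z' t.
  elim=> {z z'} [z z' [zz' lt]|z|z z' _ h|z z' z'' _ h1 _ h2] t //.
  - have [zs _ zu] := IH z (leq_trans lt vN).
    have [t' [z't' it'] _] := IH z' (leq_trans (step_rank zz') (leq_trans (ltnW lt) vN)).
    have up t1 : has_nf z' t1 -> has_nf z t1.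
      by case=> a b; split=> //; apply: rt_trans a; exact: rt_step.
    split=> [zt|]; last exact: up.
    by rewrite (zu _ zt) -(zu _ (up _ (conj z't' it'))); split.
  - by rewrite h.
  - by rewrite h1 h2.
exists s; first by split=> //; apply: rt_trans ws; exact: rt_step.
move=> t [/clos_rt_rt1n_iff h it]; case: h it => [it|w' t' vw' w't' it].
  by rewrite it in niv.
apply: us; apply/same; last by split; [apply/clos_rt_rt1n_iff; exact: w't'|].
move: vw vw' => /stepP[p [q [-> ->]]] /stepP[p' [q' [e ->]]].
exact: local_confluence.
Qed.

Lemma cong_same_nf v w : cong [:: (l, r)] v w -> forall t, has_nf v t <-> has_nf w t.
Proof.
elim=> {v w} [v w vw|v|v w _ h|z z' z'' _ h1 _ h2] t //; last first.
- by rewrite h1 h2.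
- by rewrite h.
have up t1 : has_nf w t1 -> has_nf v t1.
  by case=> a b; split=> //; apply: rt_trans a; exact: rt_step.
split=> [vt|]; last exact: up.
have [s _ us] := unique_nf v; have [s' ws' _] := unique_nf w.
by rewrite (us _ vt) -(us _ (up _ ws')).
Qed.

Lemma irr_cong_eq v w : irr v -> irr w -> cong [:: (l, r)] v w -> v = w.
Proof.
move=> iv iw /cong_same_nf/(_ w)[_ h]; apply/esym/has_nf_irr => //; apply: h.
by split=> //; exact: rt_refl.
Qed.

Lemma cong_irr v : exists2 w, irr w & cong [:: (l, r)] v w.
Proof.
have [w [vw iw] _] := unique_nf v; exists w => //.
by elim: vw => {iw} [a b ab|a|a b c _ h _ h']; [exact: rst_step|exact: rst_refl|exact: rst_trans h h'].
Qed.

End Confluence.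

(** * Normal forms over the original letters *)

Section Words.
Variable T : eqType.
Implicit Types s t u v w : seq T.

Lemma suffix_comparable s t w : suffix s w -> suffix t w -> size s <= size t -> suffix s t.
Proof.
move=> /suffixP[p ->] /suffixP[q e] le.
have [|r _ ->] := cat_eq_split _ (esym e); last exact: suffix_suffix.
by have := congr1 size e; rewrite !size_cat; lia.
Qed.

Lemma cat_injr s t u : s ++ u = t ++ u -> s = t.
Proof.
move=> e; have sz : size s = size t.
  by have := congr1 size e; rewrite !size_cat => /addIn.
by move/eqP: e; rewrite eqseq_cat // => /andP[/eqP].
Qed.

Lemma cat_injl s t u : u ++ s = u ++ t -> s = t.
Proof. by move/eqP; rewrite eqseq_cat // eqxx => /eqP. Qed.

Definition wpow s m := flatten (nseq m s).

Lemma wpowS s m : wpow s m.+1 = s ++ wpow s m. Proof. by []. Qed.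

Lemma wpowD s m k : wpow s (m + k) = wpow s m ++ wpow s k.
Proof. by rewrite /wpow nseqD flatten_cat. Qed.

Lemma wpow1 s : wpow s 1 = s. Proof. exact: cats0. Qed.

Lemma wpowSr s m : wpow s m.+1 = wpow s m ++ s.
Proof. by rewrite -addn1 wpowD wpow1. Qed.

Lemma size_wpow s m : size (wpow s m) = m * size s.
Proof. by elim: m => //= m IH; rewrite wpowS size_cat IH mulSn. Qed.

Lemma wpow_comm s t m : s ++ t = t ++ s -> wpow s m ++ t = t ++ wpow s m.
Proof.
move=> e; elim: m => [|m IH]; first by rewrite cats0.
by rewrite wpowS -catA IH catA e -catA.
Qed.

Lemma suffix_wpowP s w : s != [::] ->
  exists m v, w = v ++ wpow s m /\ ~~ suffix s v.
Proof.
move=> s0; have [N] := ubnP (size w); elim: N w => // N IH w; rewrite ltnS => wN.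
have [/suffixP[v ew]|h] := boolP (suffix s w); last first.
  by exists 0, w; rewrite cats0.
have [|m [t [ev h]]] := IH v.
  by apply: leq_trans wN; rewrite ew size_cat; case: s s0 {ew IH} => //= *; lia.
by exists m.+1, t; rewrite ew ev wpowSr catA.
Qed.

End Words.

Section Letters.
Variables (n : nat) (E : relation (seq 'I_n)).
Hypothesis Erefl : forall v, E v v.
Hypothesis Etrans : forall v w t, E v w -> E w t -> E v t.
Hypothesis Ectx : forall p q v w, E v w -> E (p ++ v ++ q) (p ++ w ++ q).
Hypothesis Ene : forall v, E v [::] -> v = [::].
Variables (d : seq 'I_n) (z x y : 'I_n).
Let l := rcons d z.
Hypothesis d0 : d != [::].
Hypothesis El : E l [:: x; y].
Hypothesis Euniq : forall v w, irr l v -> irr l w -> E v w -> v = w.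
Hypothesis Eirr : forall v, exists2 w, irr l w & E v w.
Hypothesis nxy : ~~ suffix [:: x; y] l.

Lemma irr_catl v w : irr l (v ++ w) -> irr l v.
Proof. by apply: contra => h; apply: infix_catr. Qed.

Lemma irr_rcons v a : irr l v -> ~~ suffix l (rcons v a) -> irr l (rcons v a).
Proof. by move=> iv ns; rewrite /irr infix_rconsl negb_or ns. Qed.

Lemma irr_small w : size w <= size d -> irr l w.
Proof.
by move=> le; apply/negP => /size_infix; rewrite size_rcons ltnNge le.
Qed.

Lemma suffix_l_rcons w a : suffix l (rcons w a) -> z = a /\ suffix d w.
Proof. by rewrite suffix_rcons => /andP[/eqP]. Qed.

Lemma not_suffix_l_xy w : ~~ suffix l (w ++ [:: x; y]).
Proof.
apply/negP => h; move/negP: nxy; apply; apply: suffix_comparable (suffix_suffix w _) h _.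
by rewrite size_rcons; case: d d0.
Qed.

(** A new occurrence of [l] ends at the added [x] or [y]. The latter would make [l] end in [xy]; the
    former needs [z = x] and [w] ending in [d]. *)
Lemma irr_xy_noncascade w : irr l w -> (z = x -> ~~ suffix d w) -> irr l (w ++ [:: x; y]).
Proof.
move=> iw h; have -> : w ++ [:: x; y] = rcons (rcons w x) y by rewrite -!cats1 -catA.
apply: irr_rcons; last by rewrite -!cats1 -catA not_suffix_l_xy.
by apply: irr_rcons => //; apply/negP => /suffix_l_rcons[/h/negP].
Qed.

Lemma irr_xy_cascade w m : z = x -> irr l w -> ~~ suffix d w -> irr l (w ++ x :: nseq m y).
Proof.
move=> zx iw h; elim: m => [|m IH].
  by rewrite cats1; apply: irr_rcons => //; apply/negP => /suffix_l_rcons[_]; apply/negP.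
have e : w ++ x :: nseq m.+1 y = rcons (w ++ x :: nseq m y) y.
  by rewrite rcons_cat -addn1 nseqD cats1 rcons_cons.
(* An occurrence of [l] ending at the last [y] forces [x = z = y]; then it ends in [xx], that is in
   [xy]. *)
rewrite e; apply: irr_rcons => //; apply/negP => sl; have [zy _] := suffix_l_rcons sl.
move: sl; rewrite -e -zy zx (_ : x :: nseq m.+1 x = nseq m x ++ [:: x; x]).
  by rewrite catA -{3}zx zy; apply/negP; rewrite not_suffix_l_xy.
by rewrite -(nseqD m 2) addn2.
Qed.

Definition letter_lang w := w != [::] /\ irr l w.

Let psi (a : 'I_n) := [:: a].

Lemma phiB_letters w : phiB psi w = w. Proof. exact: flatten_seq1. Qed.

Lemma nf_structure_letters c b K :
  (forall a al, letter_lang al -> exists be, letter_lang be /\ tail_mult E psi c b K a al be) ->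
  nf_structure E psi letter_lang c b K.
Proof.
have irr1 a : irr l [:: a] by apply: irr_small; case: d d0.
move=> hm; split=> //.
- by move=> a a' /Euniq h; case: (h (irr1 a) (irr1 a')).
- by move=> al [].
- apply: regular_and.
    by apply: regular_ext (regular_compl (@regular_nil 'I_n)) => w; split=> /eqP.
  by apply: regular_ext (regular_compl (regular_infix l)) => w; split=> /negP.
- move=> w w0; have [v iv e] := Eirr w; exists v; rewrite phiB_letters; split=> //; split=> //.
  by apply: contra_neq w0 => v0; apply: Ene; rewrite -v0.
- by move=> al be [_ ia] [_ ib]; rewrite !phiB_letters; apply: Euniq.
- by move=> be ga [_ /irr_catl].
Qed.

Lemma letter_mult_irr c b K a al : 0 < K -> letter_lang al -> ~~ suffix l (rcons al a) ->
  exists be, letter_lang be /\ tail_mult E psi c b K a al be.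
Proof.
move=> K0 [al0 ia] ns; exists (rcons al a); split.
  by split; [case: al {al0 ia ns}|exact: irr_rcons].
by left; exists al, [::], [:: a]; rewrite cats0 cats1.
Qed.

Lemma nf_structure_letters_noncascade :
  (z = x -> forall w, irr l (w ++ d) -> ~~ suffix d w) ->
  nf_structure E psi letter_lang x y (size l).
Proof.
move=> nc; have sl : 1 < size l by rewrite size_rcons; case: d d0.
apply: nf_structure_letters => a al La.
have [sfx|] := boolP (suffix l (rcons al a)); last exact: letter_mult_irr (ltnW sl) La.
have [za /suffixP[w ew]] := suffix_l_rcons sfx.
move: La => [al0]; rewrite ew => ia; exists (w ++ [:: x; y]); split.
  split; first by case: w {ew ia}.
  by apply: irr_xy_noncascade (irr_catl ia) _ => /nc; apply.
left; exists w, d, [:: x; y]; rewrite !phiB_letters -za; split=> //.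
by rewrite size_rcons.
Qed.

Lemma E_cascade m : z = x -> E (rcons (wpow d m) x) (x :: nseq m y).
Proof.
move=> zx; elim: m => [|m IH]; first exact: Erefl.
apply: (Etrans (w := wpow d m ++ [:: x; y])).
  have := Ectx (wpow d m) [::] El; rewrite !cats0.
  by rewrite wpowSr rcons_cat /l zx.
have := Ectx [::] [:: y] IH; rewrite /= cats1 -!cats1 -catA /=.
by rewrite -(nseqD m 1) addn1.
Qed.

Lemma nf_structure_letters_single c : d = [:: c] -> z = x ->
  nf_structure E psi letter_lang c y (size l).
Proof.
move=> dc zx; have sl : 1 < size l by rewrite size_rcons; case: d d0.
have wc m : wpow d m = nseq m c by rewrite dc; elim: m => //= m IH; rewrite wpowS IH.
apply: nf_structure_letters => a al La.
have [sfx|] := boolP (suffix l (rcons al a)); last exact: letter_mult_irr (ltnW sl) La.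
have [za sd] := suffix_l_rcons sfx.
have [[|m] [w [ew sw]]] := suffix_wpowP al d0.
  by rewrite ew cats0 (negPf sw) in sd.
move: La => [al0]; rewrite ew => ia; exists (w ++ x :: nseq m.+1 y); split.
  split; first by case: w {ew ia sw}.
  exact: irr_xy_cascade (irr_catl ia) _.
(* [w c^(m+1)] faces [w x y^(m+1)]: one [c] is set against [x], and the last [y] sticks out. *)
right; exists w, [:: c], [::], [:: x], [:: y], m; split=> //.
- by rewrite !(ltnW sl).
- by rewrite wc /= cats0.
- by rewrite -addn1 nseqD.
move=> i; rewrite !phiB_letters -za zx; have := E_cascade i.+1 zx.
by rewrite wc -cats1 -[nseq i y ++ _](nseqD i 1) addn1.
Qed.

End Letters.

(** * Greedy parsing into blocks *)

Section Near.
Variable B : Type.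
Implicit Types al be ga : seq B.

Definition near K al be := exists g p q,
  [/\ al = g ++ p, be = g ++ q, size p <= K & size q <= K].

Lemma near_refl K al : near K al al.
Proof. by exists al, [::], [::]; rewrite cats0. Qed.

Lemma near_sym K al be : near K al be -> near K be al.
Proof. by case=> g [p [q [e1 e2 h1 h2]]]; exists g, q, p. Qed.

End Near.

Lemma near_trans (B : eqType) K K' (al be ga : seq B) :
  near K al be -> near K' be ga -> near (K + K') al ga.
Proof.
case=> g [p [q [-> -> sp sq]]] [g' [p' [q' [e -> sp' sq']]]].
have [le|/ltnW le] := leqP (size g) (size g').
  have [t eg eq] := cat_eq_split le e.
  exists g, p, (t ++ q'); rewrite eg -catA; split=> //; first by lia.
  by move: sq; rewrite eq !size_cat; lia.
have [t eg eq] := cat_eq_split le (esym e).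
exists g', (t ++ p), q'; rewrite eg -catA; split=> //; last by lia.
by move: sp'; rewrite eq !size_cat; lia.
Qed.

Section Parse.
Variables (n : nat) (d : seq 'I_n).
Hypothesis d0 : d != [::].
Let B := option 'I_n.
Implicit Types (v w t : seq 'I_n) (s g : seq B).

(* [None] is the extra generator standing for the word [d]; parsing replaces
   occurrences of [d] greedily from the left. *)
Definition block_psi (b : B) := if b is Some a then [:: a] else d.

Let ex := phiB block_psi.
Let D : seq B := map Some d.

Lemma size_D : size D = size d. Proof. exact: size_map. Qed.

Lemma D_neq0 : D != [::]. Proof. by rewrite /D; case: d d0. Qed.

Lemma ex_cat s g : ex (s ++ g) = ex s ++ ex g. Proof. exact: phiB_cat. Qed.

Lemma ex_rcons s b : ex (rcons s b) = ex s ++ block_psi b.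
Proof. by rewrite -cats1 ex_cat /ex /phiB /= cats0. Qed.

Lemma ex_map w : ex (map Some w) = w.
Proof. by rewrite /ex /phiB -map_comp; exact: flatten_seq1. Qed.

Lemma ex_nseq m : ex (nseq m None) = wpow d m.
Proof. by rewrite /ex /phiB map_nseq. Qed.

Lemma size_ex s : size s <= size (ex s).
Proof.
elim: s => //= b s IH; rewrite -cat1s ex_cat size_cat.
have : 0 < size (ex [:: b]).
  by rewrite /ex /phiB /= cats0; case: b => [a|] //=; case: d d0.
by rewrite -/(ex s) /=; lia.
Qed.

Definition push s (a : 'I_n) : seq B :=
  let s' := rcons s (Some a) in
  if suffix D s' then rcons (take (size s' - size d) s') None else s'.

Definition bparse w : seq B := foldl push [::] w.

Lemma parse_rcons w a : bparse (rcons w a) = push (bparse w) a.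
Proof. exact: foldl_rcons. Qed.

Lemma pushP s a : (exists2 g, rcons s (Some a) = g ++ D & push s a = rcons g None) \/
  (~~ suffix D (rcons s (Some a)) /\ push s a = rcons s (Some a)).
Proof.
rewrite /push; case: ifP => [/suffixP[g e]|/negbT]; last by right.
left; exists g => //; rewrite e size_cat size_D addnK take_size_cat //.
Qed.

Lemma ex_push s a : ex (push s a) = rcons (ex s) a.
Proof.
have [[g e ->]|[_ ->]] := pushP s a; last by rewrite ex_rcons cats1.
by rewrite ex_rcons /= -[d in LHS]ex_map -ex_cat -e ex_rcons cats1.
Qed.

Lemma ex_parse w : ex (bparse w) = w.
Proof. by elim/last_ind: w => // w a IH; rewrite parse_rcons ex_push IH. Qed.

(** Greediness as a local condition that an automaton can check: a letter must not complete a copy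
    of [d], and spelling out a block must not complete one before the block ends. *)
Definition push_ok s (b : B) : Prop :=
  if b is Some a then ~~ suffix D (rcons s b)
  else forall i, 0 < i < size d -> ~~ suffix D (s ++ take i D).

Definition canonical s := forall g b, prefix (rcons g b) s -> push_ok g b.

Lemma prefix_rconsr (T : eqType) (s t : seq T) b :
  prefix s (rcons t b) -> s = rcons t b \/ prefix s t.
Proof.
move=> /prefixP[q]; case/lastP: q => [|q a]; first by rewrite cats0; left.
by rewrite -rcons_cat => /rcons_inj[-> _]; right; exact: prefix_prefix.
Qed.

Lemma canonical_nil : canonical [::].
Proof. by case. Qed.

Lemma canonical_rcons s b : canonical (rcons s b) <-> canonical s /\ push_ok s b.
Proof.
split=> [h|[h1 h2] g a /prefix_rconsr[/rcons_inj[-> ->] //|]]; last exact: h1.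
split; last by apply: h; exact: prefix_refl.
by move=> g a p; apply: h; apply: prefix_trans p (prefix_rcons _ _).
Qed.

Lemma canonical_catl s g : canonical (s ++ g) -> canonical s.
Proof.
by move=> h g' b p; apply: h; exact: prefix_catl.
Qed.

Lemma canonical_not_suffix s a : canonical (rcons s (Some a)) -> ~~ suffix D (rcons s (Some a)).
Proof. by case/canonical_rcons. Qed.

Lemma take_rcons_last i s : 0 < i <= size s -> exists b, take i s = rcons (take i.-1 s) b.
Proof.
case: i => // i /= h; case e: (drop i s) => [|b s'].
  by have := size_drop i s; rewrite e /=; lia.
exists b; rewrite -addn1 takeD e /= take0 cats1 //.
Qed.

Lemma canonical_push s a : canonical s -> canonical (push s a).
Proof.
move=> cs; have [[g e ->]|[ns ->]] := pushP s a; last by apply/canonical_rcons.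
apply/canonical_rcons.
have [d' [b ed]] : exists d' b, D = rcons d' b.
  by case/lastP: (D) D_neq0 => // d' b _; exists d', b.
have es : s = g ++ d' by move: e; rewrite ed -rcons_cat => /rcons_inj[].
split; first by apply: (@canonical_catl g d'); rewrite -es.
move=> i hi; have [|b' eb] := @take_rcons_last i D; first by rewrite size_D; lia.
have c : canonical (g ++ take i D).
  apply: (@canonical_catl _ (drop i d')); rewrite -catA.
  suff -> : take i D ++ drop i d' = d' by rewrite -es.
  rewrite ed -cats1 takel_cat ?cat_take_drop //.
  by have := size_D; rewrite ed size_rcons; lia.
have : b' \in D by apply: (@mem_take i); rewrite eb mem_rcons mem_head.
case/mapP=> a' _ eb'; move: c; rewrite eb eb' -rcons_cat.
exact: canonical_not_suffix.
Qed.

Lemma canonical_parse w : canonical (bparse w).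
Proof.
elim/last_ind: w => [|w a IH]; first exact: canonical_nil.
by rewrite parse_rcons; exact: canonical_push.
Qed.

Lemma parse_ex s : canonical s -> bparse (ex s) = s.
Proof.
elim/last_ind: s => // s b IH /canonical_rcons[/IH {}IH ok]; rewrite ex_rcons.
case: b ok => [a|] /= ok.
  rewrite cats1 parse_rcons IH; have [[g e _]|[_ ->]] := pushP s a => //.
  by move: ok; rewrite e suffix_suffix.
(* While the letters of a block are read, [push_ok] prevents any contraction before the last one. *)
have inner v q : v ++ q = d -> q != [::] -> bparse (ex s ++ v) = s ++ map Some v.
  elim/last_ind: v q => [|v a IHv] q e q0; first by rewrite !cats0.
  rewrite -rcons_cat parse_rcons (IHv (a :: q)) //; last by rewrite -e cat_rcons.
  have [[g eg _]|[_ ->]] := pushP (s ++ map Some v) a; last by rewrite rcons_cat map_rcons.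
  have hi : 0 < (size v).+1 < size d.
    by rewrite -e size_cat size_rcons; case: q q0 {e} => //= *; lia.
  have tk : take (size v).+1 D = map Some (rcons v a).
    by rewrite /D -{1}e map_cat take_size_cat // size_map size_rcons.
  by have := ok _ hi; rewrite tk map_rcons -rcons_cat eg suffix_suffix.
have [d' [a ed]] : exists d' a, d = rcons d' a.
  by case/lastP: (d) d0 => // d' a _; exists d', a.
rewrite [X in ex s ++ X]ed -rcons_cat parse_rcons (inner d' [:: a]) ?cats1 //.
have e : rcons (s ++ map Some d') (Some a) = s ++ D by rewrite rcons_cat -map_rcons -ed.
have [[g eg ->]|[]] := pushP (s ++ map Some d') a; last by rewrite e suffix_suffix.
by move: eg; rewrite e => /cat_injr ->.
Qed.

Lemma near_push s a : near (size d) s (push s a).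
Proof.
have [[g e ->]|[_ ->]] := pushP s a; last first.
  exists s, [::], [:: Some a]; rewrite cats0 cats1; split=> //.
  by case: d d0.
have [d' [b ed]] : exists d' b, D = rcons d' b.
  by case/lastP: (D) D_neq0 => // d' b _; exists d', b.
have es : s = g ++ d' by move: e; rewrite ed -rcons_cat => /rcons_inj[].
exists g, d', [:: None]; rewrite cats1; split=> //; last by case: d d0.
by have := size_D; rewrite ed size_rcons => <-.
Qed.

Lemma near_parse_cat w v : near (size d * size v) (bparse w) (bparse (w ++ v)).
Proof.
elim/last_ind: v => [|v a IH]; first by rewrite cats0; exact: near_refl.
rewrite size_rcons mulnS addnC -rcons_cat parse_rcons.
exact: near_trans IH (near_push _ _).
Qed.

Lemma suffix_D_None g s : suffix D (g ++ None :: s) = suffix D s.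
Proof.
apply/idP/idP => [h|]; last first.
  by move=> h; rewrite -cat_rcons; apply: suffix_catr.
have [le|lt] := leqP (size D) (size s).
  by apply: suffix_comparable h _ le; rewrite -cat_rcons suffix_suffix.
have : suffix (None :: s) D by apply: suffix_comparable (suffix_suffix g _) h lt.
by move=> /suffixW/mem_infix/(_ _ (mem_head _ _))/mapP[].
Qed.

Lemma push_None g s a : push (g ++ None :: s) a = g ++ None :: push s a.
Proof.
have [[g' e ->]|[ns ->]] := pushP s a.
  have [[g2 e2 ->]|[]] := pushP (g ++ None :: s) a; last first.
    by rewrite rcons_cat rcons_cons e -cat_cons catA suffix_suffix.
  move: e2; rewrite rcons_cat rcons_cons e -cat_cons catA => /cat_injr <-.
  by rewrite rcons_cat.
have [[g2 e2 _]|[_ ->]] := pushP (g ++ None :: s) a; last by rewrite rcons_cat.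
have := suffix_suffix g2 D.
by rewrite -e2 rcons_cat rcons_cons suffix_D_None (negPf ns).
Qed.

(** [d] is spelled in original letters, so no later contraction crosses a closed block: parsing
    restarts from scratch after it. *)
Lemma parse_None_cat s v : canonical (rcons s None) ->
  bparse (ex (rcons s None) ++ v) = rcons s None ++ bparse v.
Proof.
move=> cs; elim/last_ind: v => [|v a IH]; first by rewrite !cats0 parse_ex.
by rewrite -rcons_cat !parse_rcons IH !cat_rcons push_None.
Qed.

Lemma trailing_run s : (exists t, s = map Some t) \/ exists g t, s = rcons g None ++ map Some t.
Proof.
elim/last_ind: s => [|s b IH]; first by left; exists [::].
case: b => [a|]; last by right; exists s, [::]; rewrite cats0.
case: IH => [[t ->]|[g [t ->]]]; first by left; exists (rcons t a); rewrite map_rcons.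
by right; exists g, (rcons t a); rewrite map_rcons rcons_cat.
Qed.

Lemma canonical_not_suffix_D s : canonical s -> ~~ suffix D s.
Proof.
case/lastP: s => [|s [a|]] c; first by rewrite suffixs0 D_neq0.
  exact: canonical_not_suffix.
by rewrite -cats1 suffix_D_None suffixs0 D_neq0.
Qed.

Lemma canonical_run g t : canonical (g ++ map Some t) -> ~~ suffix d t.
Proof.
move/canonical_not_suffix_D; apply: contra => /suffixP[q ->].
by rewrite map_cat catA suffix_suffix.
Qed.

(** If the letters after the last block, or all letters when there is none, were at least [size d]
    many, they would end in [d] and have been contracted. *)
Lemma parse_suffix w : suffix d w ->
  exists s t, bparse w = rcons s None ++ map Some t /\ size t < size d.
Proof.
move=> sw; have := @canonical_parse w; have := ex_parse w.
case: (trailing_run (bparse w)) => [[t ->]|[s [t ->]]].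
  by rewrite ex_map => -> /(@canonical_run [::]); rewrite sw.
rewrite ex_cat ex_map => e /canonical_run nt; exists s, t; split=> //.
rewrite ltnNge; apply: contra nt => le; apply: suffix_comparable sw _ le.
by rewrite -e suffix_suffix.
Qed.

Lemma parse_short t : size t < size d -> bparse t = map Some t.
Proof.
elim/last_ind: t => // t a IH; rewrite size_rcons => h.
rewrite parse_rcons IH ?(ltnW h) // map_rcons.
have [[g e _]|[_ ->]] // := pushP (map Some t) a.
by have := congr1 size e; rewrite size_cat size_D size_rcons size_map; lia.
Qed.

(** Reading [d] after the pending letters [t] closes a block, and the new pending word [t'] is
    shorter than [t] by exactly what [s] spells. *)
Lemma parse_block t : size t < size d -> exists s t',
  [/\ size t' < size d, size (ex s) + size t' = size t, t ++ d = ex s ++ d ++ t' &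
      forall v, bparse (t ++ d ++ v) = rcons s None ++ bparse (t' ++ v)].
Proof.
move=> lt; have [s [t' [e lt']]] := parse_suffix (suffix_suffix t d).
have eq : t ++ d = ex s ++ d ++ t'.
  by rewrite -{1}(ex_parse (t ++ d)) e ex_cat ex_map ex_rcons -catA.
exists s, t'; split=> //.
  by have := congr1 size eq; rewrite !size_cat; lia.
move=> v; rewrite -parse_None_cat; last first.
  by apply: (@canonical_catl _ (map Some t')); rewrite -e; exact: canonical_parse.
by rewrite ex_rcons /= catA eq -!catA.
Qed.

(* Appending [d] shifts the pending prefix [t]; once its length is kept twice
   in a row it commutes with [d], and from then on each [d] is one block. *)
Lemma parse_stable t : size t < size d -> exists J (p r : seq B),
  J <= 2 * size t /\ forall i, bparse (t ++ wpow d (J + i)) = p ++ nseq i None ++ r.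
Proof.
have [N] := ubnP (size t); elim: N t => // N IH t; rewrite ltnS => tN lt.
have ex0 s : size (ex s) = 0 -> s = [::].
  by move=> h; apply: size0nil; have := size_ex s; lia.
have [s [t' [lt' sz e ps]]] := parse_block lt.
have [h|h] := ltnP (size t') (size t).
  have [||J [p [v [hJ hp]]]] := IH t' => //; first by exact: leq_trans tN.
  exists J.+1, (rcons s None ++ p), v; split; first by lia.
  by move=> i; rewrite addSn wpowS ps hp -catA.
have s0 : s = [::] by apply: ex0; lia.
subst s; rewrite /= in e ps sz.
have [ett|ntt] := eqVneq t' t.
  exists 0, [::], (map Some t); split=> //; elim=> [|i IHi].
    by rewrite cats0 parse_short.
  by rewrite add0n wpowS ps ett -{1}[i]add0n IHi.
have [s2 [t2 [lt2 sz2 e2 ps2]]] := parse_block lt'.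
have [h2|h2] := ltnP (size t2) (size t).
  have [||J [p [v [hJ hp]]]] := IH t2 => //; first by exact: leq_trans tN.
  exists J.+2, (None :: rcons s2 None ++ p), v; split; first by lia.
  by move=> i; rewrite !addSn !wpowS ps ps2 hp /= -!catA.
have s20 : s2 = [::] by apply: ex0; lia.
move: e2; rewrite s20 /= => e2; case/eqP: ntt.
(* From [t d = d t'] and [t' d = d t2] with equal lengths, both [t] and [t'] are the prefix of [d]
   of that length. *)
have a1 : take (size t) (t ++ d) = t by rewrite take_size_cat.
have a2 : take (size t) (t' ++ d) = t' by rewrite take_size_cat //; lia.
by rewrite -a1 -a2 e e2 !takel_cat // ltnW.
Qed.

Lemma parse_stable_uniform t : size t < size d -> exists p r : seq B,
  forall i, bparse (t ++ wpow d (2 * size d + i)) = p ++ nseq i None ++ r.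
Proof.
move=> lt; have [J [p [v [hJ hp]]]] := parse_stable lt.
exists (p ++ nseq (2 * size d - J) None), v => i.
have -> : 2 * size d + i = J + (2 * size d - J + i) by lia.
by rewrite hp nseqD -!catA.
Qed.

(** The first [size d] copies of [y] may still belong to a block begun in [w]. A block completed
    later would lie entirely among the [y], making [d] a power of [y]. *)
Lemma parse_nseq_tail w (y : 'I_n) j : d != nseq (size d) y ->
  bparse (w ++ nseq (size d) y ++ nseq j y) = bparse (w ++ nseq (size d) y) ++ nseq j (Some y).
Proof.
move=> nd; elim: j => [|j IH]; first by rewrite !cats0.
rewrite -[in LHS]addn1 nseqD !catA cats1 parse_rcons -catA IH -[in RHS]addn1 nseqD catA cats1.
set s := bparse _ ++ _; have [[g e _]|[_ ->]] // := pushP s y.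
case/eqP: nd; have := congr1 ex e; rewrite ex_rcons ex_cat ex_map /s.
have -> : nseq j (Some y) = map Some (nseq j y) by rewrite map_nseq.
rewrite ex_cat ex_map ex_parse /= -!catA -[nseq j y ++ _](nseqD j 1) -nseqD => h.
have : suffix d (nseq (size d + (j + 1)) y).
  apply: (@suffix_comparable _ _ _ (w ++ nseq (size d + (j + 1)) y)).
  - by rewrite h suffix_suffix.
  - exact: suffix_suffix.
  - by rewrite size_nseq leq_addr.
move/suffixW/mem_infix => sub; apply/all_pred1P/allP => a /sub.
by rewrite mem_nseq => /andP[_].
Qed.

Lemma regular_canonical : regular canonical.
Proof.
have r1 := regular_suffix D.
have r2 : regular (fun u : seq B => exists u1 u2, [/\ u = u1 ++ u2,
    (exists i : 'I_(size d), 0 < i /\ suffix D (u1 ++ take i D)) & u2 = [:: None]]).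
  apply: regular_cat; last exact: regular_word.
  by apply: regular_exists => i; apply: regular_guard; exact: (regular_quotient (take i D) r1).
apply: regular_ext (regular_compl (regular_cat (regular_or r1 r2) (regular_full _))) => s.
split=> [h g [a|]|c].
- move=> /prefixP[q e]; apply/negP => sD; apply: h.
  by exists (rcons g (Some a)), q; split=> //; left.
- move=> /prefixP[q e] i /andP[i0 lti]; apply/negP => sD; apply: h.
  exists (rcons g None), q; split=> //; right; exists g, [:: None].
  by rewrite cats1; split=> //; exists (Ordinal lti).
case=> u [v [e hu _]]; move: c; rewrite e => /canonical_catl c.
case: hu => [|[u1 [u2 [eu [i [i0 sD]] eu2]]]].
  by rewrite (negPf (canonical_not_suffix_D c)).
move: c; rewrite eu eu2 cats1 => /canonical_rcons[_ /(_ i)].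
by rewrite i0 ltn_ord sD => /(_ isT).
Qed.

End Parse.

(** * Normal forms over letters and blocks *)

(** The two words differ right after [w], so a prefix common to both cannot pass that point. *)
Lemma common_prefix (T : eqType) (g w s1 s2 t1 t2 : seq T) a b : a != b ->
  g ++ s1 = w ++ a :: t1 -> g ++ s2 = w ++ b :: t2 -> exists w', w = g ++ w'.
Proof.
move=> ab e1 e2; have [le|lt] := leqP (size g) (size w).
  by have [t -> _] := cat_eq_split le e1; exists t.
have [[|c t] eg e1'] := cat_eq_split (ltnW lt) (esym e1).
  by move: lt; rewrite eg cats0 ltnn.
move: e2; rewrite eg -catA => /cat_injl[e2 _]; case: e1' => e1' _.
by rewrite -e2 -e1' eqxx in ab.
Qed.

Section Blocks.
Variables (n : nat) (E : relation (seq 'I_n)).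
Hypothesis Erefl : forall v, E v v.
Hypothesis Esym : forall v w, E v w -> E w v.
Hypothesis Etrans : forall v w t, E v w -> E w t -> E v t.
Hypothesis Ectx : forall p q v w, E v w -> E (p ++ v ++ q) (p ++ w ++ q).
Hypothesis Ene : forall v, E v [::] -> v = [::].
Variables (d : seq 'I_n) (x y : 'I_n).
Let l := rcons d x.
Hypothesis d1 : 1 < size d.
Hypothesis El : E l [:: x; y].
Hypothesis Euniq : forall v w, irr l v -> irr l w -> E v w -> v = w.
Hypothesis Eirr : forall v, exists2 w, irr l w & E v w.
Hypothesis nxy : ~~ suffix [:: x; y] l.
Hypothesis head_d : head x d != x.
Hypothesis nyd : d != nseq (size d) y.

Let B := option 'I_n.
Let psi := block_psi d.
Let ex := phiB psi.
Let k := size d.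

Lemma block_d0 : d != [::]. Proof. by case: d d1. Qed.
Let d0 := block_d0.

Lemma dE : d = head x d :: behead d. Proof. by case: d d1. Qed.

(* The overlap [l s = t l] forces [t x y = x y s] as words once both sides
   are too short to be reducible. *)
Lemma unbordered t : t != [::] -> size t < size l -> prefix t l -> ~~ suffix t l.
Proof.
move=> t0 lt /prefixP[s el]; apply/negP => /suffixP[p el'].
have t1 : 1 < size t.
  case: t t0 lt el el' => // a [|b t] // _ _ el el'; exfalso.
  have ax : a = x by move: el'; rewrite /l cats1 => /rcons_inj[_ ->].
  by move: head_d; move: el; rewrite /l {1}dE ax /= => -[->]; rewrite eqxx.
have sp : size p = size s.
  by have := congr1 size el; rewrite el' !size_cat; lia.
have sz : size t + size s = k.+1.
  by have := congr1 size el; rewrite size_rcons size_cat => <-.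
have eE : E (p ++ [:: x; y]) ([:: x; y] ++ s).
  have h1 := Ectx p [::] El; rewrite !cats0 in h1.
  have h2 := Ectx [::] s El; rewrite /= in h2.
  apply: Etrans (Esym h1) _; apply: Etrans h2.
  by rewrite {1}el {1}el' catA; exact: Erefl.
have irr_le w : size w <= size l -> w != l -> irr l w.
  move=> le ne; apply/negP => /infixP[u [v ew]]; move: le ne; rewrite ew !size_cat.
  rewrite addnCA -{2}[size l]addn0 leq_add2l leqn0 addn_eq0 !size_eq0.
  by case/andP=> /eqP-> /eqP->; rewrite /= cats0 eqxx.
(* Neither side is longer than [l], and neither is [l]: one ends in [xy], the other starts with [x].
   So both are irreducible. *)
have e : p ++ [:: x; y] = [:: x; y] ++ s.
  have sl : size s + 2 <= size l by rewrite size_rcons -/k -sz; lia.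
  apply: Euniq eE; apply: irr_le.
  - by rewrite size_cat sp.
  - by apply: contra nxy => /eqP <-; exact: suffix_suffix.
  - by rewrite size_cat addnC.
  - by apply: contra head_d => /eqP; rewrite /l {1}dE => -[<- _].
(* The last letter of [s] is that of [l], so [x = y]. If [s] has length one, then [p] is [x] and [d]
   starts with [x]; otherwise [l] ends in [xx], that is in [xy]. *)
case/lastP: s sp sz el e {eE} => [|s a] sp sz el e.
  by move: sz lt; rewrite size_rcons -/k addn0 => ->; rewrite ltnn.
have ax : a = x by move: el; rewrite /l -rcons_cat => /rcons_inj[].
have : rcons (rcons p x) y = rcons ([:: x; y] ++ s) a.
  by rewrite rcons_cat -e -!cats1 -catA.
case/rcons_inj=> e1 ya; move: e1; case/lastP: s sp sz el {e} => [|s b] sp sz el e1.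
  case: p sp el' e1 => // c [|? ?] // _ el' [cx _].
  by move: head_d; move: el'; rewrite /l {1}dE cx /= => -[->]; rewrite eqxx.
move: e1; rewrite -[RHS]/(rcons [:: x, y & s] b) => /rcons_inj[_ bx].
move/negP: nxy; apply; rewrite el -!cats1 -!catA /= ya bx !catA.
exact: suffix_suffix.
Qed.

(** A new occurrence of [l] would end inside the added [d], making a nonempty prefix of [d] a suffix
    of [l]. Hence multiplication by the block generator never reduces. *)
Lemma irr_cat_d w : irr l w -> irr l (w ++ d).
Proof.
move=> iw; apply/negP => /infixP[p [q e]].
have [le|lt] := leqP (size d) (size q).
  have szs := congr1 size e; rewrite !size_cat in szs.
  have [||t ew _] := @cat_eq_split _ (p ++ l) w q d.
  - by rewrite size_cat -(leq_add2r (size d)) szs -addnA !leq_add2l.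
  - by rewrite e catA.
  by move/negP: iw; apply; apply/infixP; exists p, t; rewrite ew catA.
have [||t e1 e2] := @cat_eq_split _ w (p ++ l) d q.
- rewrite -(leq_add2r (size q)) -(size_cat (p ++ l) q) -catA -e size_cat leq_add2l.
  exact: ltnW.
- by rewrite e catA.
have t0 : t != [::] by case: t e2 {e1} => // e2; rewrite e2 ltnn in lt.
have st : size t <= size d by rewrite e2 size_cat leq_addr.
have : prefix t l by rewrite /l e2 -cats1 -catA prefix_prefix.
have lt' : size t < size l by rewrite size_rcons.
move/(unbordered t0 lt')/negP; apply.
by apply: (@suffix_comparable _ _ _ (w ++ t)) (ltnW lt'); rewrite ?suffix_suffix // -e1 suffix_suffix.
Qed.

Definition block_lang (s : seq B) := [/\ s != [::], canonical d s & irr l (ex s)].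

(** The summands bound, in order, the changed suffixes for an irreducible product, for a short
    cascade and for a long one, and the final run of [y]. The factor 3 used with it comes from
    [tail_mult_unaligned]. *)
Let K0 := k * k + (k * (k * (2 * k)) + k * (2 * k).+1) +
  ((k + 2 * k * k + k) + k * k + k * k.+1) + (2 * k).+1.

Lemma block_lang_parse w : w != [::] -> irr l w -> block_lang (bparse d w).
Proof.
move=> w0 iw; rewrite /block_lang /ex ex_parse //; split=> //; last exact: canonical_parse.
by apply: contra_neq w0 => e; rewrite -(ex_parse d w) e.
Qed.

Lemma block_mult_irr (a : B) al : block_lang al -> irr l (ex al ++ psi a) ->
  exists be, block_lang be /\ tail_mult E psi None (Some y) (3 * K0) a al be.
Proof.
move=> [al0 ca ia] i; exists (bparse d (ex al ++ psi a)); split.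
  apply: block_lang_parse => //; rewrite -size_eq0 size_cat addn_eq0 negb_and !size_eq0.
  by rewrite orbC; case: (a) => //=; rewrite d0.
have := near_parse_cat d0 (ex al) (psi a); rewrite (parse_ex d0 ca).
have sa : size (psi a) <= k by case: (a) => [b|] //; exact: ltnW d1.
move=> [g [p [q [ea eb sp sq]]]]; left; exists g, p, q.
have hK : size d * size (psi a) <= 3 * K0.
  by apply: (leq_trans (leq_mul (leqnn _) sa)); rewrite /K0 -/k; lia.
split=> //; try exact: leq_trans hK.
suff -> : phiB psi (rcons p a) = phiB psi q by exact: Erefl.
apply: (@cat_injl _ _ _ (ex g)); rewrite -!ex_cat -eb ex_parse //.
by rewrite -rcons_cat -ea ex_rcons.
Qed.

Lemma block_cascade w m : E (w ++ rcons (wpow d m) x) (w ++ x :: nseq m y).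
Proof.
have := Ectx w [::] (E_cascade Erefl Etrans Ectx El m erefl).
by rewrite !cats0.
Qed.

(** For [m <= 2 * k] both parses stay near that of [w], so the bounded shape suffices once their
    common prefix is cancelled inside [w]. *)
Lemma block_mult_bounded al w m : m <= 2 * k -> 0 < m -> canonical d al ->
  ex al = w ++ wpow d m ->
  tail_mult E psi None (Some y) (3 * K0) (Some x) al (bparse d (w ++ x :: nseq m y)).
Proof.
move=> mk m0 ca ea.
have n1 := near_parse_cat d0 w (wpow d m).
rewrite -ea (parse_ex d0 ca) size_wpow in n1.
have n2 := near_parse_cat d0 w (x :: nseq m y); rewrite /= size_nseq in n2.
have [g [p [q [eal ebe sp sq]]]] := near_trans (near_sym n1) n2.
have hK : size d * (m * size d) + size d * m.+1 <= 3 * K0.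
  rewrite -/k; have a1 : k * (m * k) <= k * (k * (2 * k)).
    by rewrite leq_mul // mulnC leq_mul.
  have a2 : k * m.+1 <= k * (2 * k).+1 by rewrite leq_mul.
  rewrite /K0; lia.
left; exists g, p, q; split=> //; try exact: leq_trans hK.
have e1 : ex g ++ ex p = w ++ head x d :: (behead d ++ wpow d m.-1).
  rewrite -ex_cat -eal -cat_cons -dE -wpowS prednK //; exact: ea.
have e2 : ex g ++ ex q = w ++ x :: nseq m y by rewrite -ex_cat -ebe; exact: ex_parse.
have [w' ew] := common_prefix head_d e1 e2.
have ep : ex p = w' ++ wpow d m.
  by apply: (@cat_injl _ _ _ (ex g)); rewrite catA -ew -ea eal; exact/esym/ex_cat.
have eq : ex q = w' ++ x :: nseq m y.
  by apply: (@cat_injl _ _ _ (ex g)); rewrite catA -ew.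
rewrite ex_rcons -/psi -/ex ep eq -catA /= cats1; exact: block_cascade.
Qed.

(** Of the copies of [d], one closes a block after [w], [2 * k] stabilise the parsing, and [i] form
    the run of blocks. Of the copies of [y], [k] are kept with [x], [i] face the blocks, and [k + 1]
    remain. *)
Lemma block_mult_long al w i : canonical d al ->
  ex al = w ++ wpow d (2 * k + i).+1 ->
  tail_mult E psi None (Some y) (3 * K0) (Some x) al
    (bparse d (w ++ x :: nseq (2 * k + i).+1 y)).
Proof.
move=> ca ea.
have [s [t [es lt]]] := parse_suffix d0 (suffix_suffix w d).
have [p [r pr]] := parse_stable_uniform d0 lt.
have cs : canonical d (rcons s None).
  by apply: (@canonical_catl _ _ _ (map Some t)); rewrite -es; apply: canonical_parse.
have exs : ex (rcons s None) ++ t = w ++ d.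
  by rewrite -[t in LHS](ex_map d) -ex_cat -es; exact: ex_parse.
have alE j : bparse d (w ++ wpow d (2 * k + j).+1) = rcons s None ++ p ++ nseq j None ++ r.
  by rewrite wpowS catA -exs -catA (parse_None_cat d0 _ cs) pr.
have exE j : ex (rcons s None ++ p ++ nseq j None ++ r) = w ++ wpow d (2 * k + j).+1.
  by rewrite -alE; exact: ex_parse.
have eal : al = rcons s None ++ p ++ nseq i None ++ r.
  by rewrite -alE -ea; exact/esym/parse_ex.
have exC u v : ex (u ++ v) = ex u ++ ex v by exact: ex_cat.
(* Passing from [i = 0] to [i = 1] inserts [d] before [ex r] on one side and appends it at the end
   on the other. *)
have comm : d ++ ex r = ex r ++ d.
  have h0 := exE 0; have h1 := exE 1; rewrite addn0 in h0; rewrite addn1 wpowSr [RHS]catA -h0 in h1.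
  move: h1; rewrite !exC [ex (nseq 0 None)]/= [ex (nseq 1 None)]cats0 -!catA /=.
  by move=> /cat_injl/cat_injl.
have n1 : near (k + 2 * k * k + k) (rcons s None ++ p) (bparse d (w ++ d)).
  exists (rcons s None), p, (map Some t); split=> //; last by rewrite size_map -/k; lia.
  apply: leq_trans (size_ex d0 _) _; have := congr1 size (pr 0).
  move: (ex_parse d (t ++ wpow d (2 * size d + 0))); rewrite pr => /(congr1 size).
  by rewrite !ex_cat !size_cat size_wpow addn0 -/k -mulnA; lia.
have n2 := near_parse_cat d0 w d.
have n3 := near_parse_cat d0 w (x :: nseq k y); rewrite /= size_nseq in n3.
have := near_trans (near_trans n1 (near_sym n2)) n3.
set Q := bparse d _ => -[g [p1 [q1 [ep1 eq1 sp1 sq1]]]].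
have ebe : bparse d (w ++ x :: nseq (2 * k + i).+1 y) = Q ++ nseq i (Some y) ++ nseq k.+1 (Some y).
  rewrite -nseqD /Q -!(cat_rcons x) -parse_nseq_tail // -nseqD.
  by congr (bparse d (_ ++ nseq _ y)); rewrite /k; lia.
rewrite ebe eal eq1 catA ep1 -!catA.
have e1 : ex g ++ ex (p1 ++ r) = w ++ head x d :: (behead d ++ wpow d (2 * k)).
  rewrite -exC catA -ep1 -catA -cat_cons -dE -wpowS.
  by have := exE 0; rewrite addn0.
have e2 : ex g ++ ex q1 = w ++ x :: nseq k y by rewrite -exC -eq1; exact: ex_parse.
have [w' ew] := common_prefix head_d e1 e2.
have ep : ex p1 ++ ex r = w' ++ wpow d (2 * k).+1.
  apply: (@cat_injl _ _ _ (ex g)); rewrite -exC e1 [RHS]catA -ew.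
  by rewrite -cat_cons -dE -wpowS.
have eq : ex q1 = w' ++ x :: nseq k y.
  by apply: (@cat_injl _ _ _ (ex g)); rewrite catA -ew.
apply: tail_mult_unaligned.
- by apply: leq_trans sp1 _; rewrite -/k /K0; lia.
- apply: leq_trans (size_ex d0 _) _.
  move: (ex_parse d (t ++ wpow d (2 * size d + 0))); rewrite pr => /(congr1 size).
  by rewrite !ex_cat !size_cat size_wpow addn0 -/k -mulnA /K0; lia.
- by apply: leq_trans sq1 _; rewrite -/k /K0; lia.
- by rewrite size_nseq /K0; lia.
(* Since [ex r] commutes with [d], the run [d^j] moves past it and the left side becomes
   [w' d^(2k+1+j) x], to which the cascade applies for every [j]. *)
move=> j; rewrite -cats1 !phiB_cat -/ex eq.
have -> : ex (nseq j None) = wpow d j by exact: ex_nseq.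
have exy m : ex (nseq m (Some y)) = nseq m y by rewrite -(map_nseq m Some y); exact: ex_map.
rewrite !exy [wpow d j ++ _]catA wpow_comm // !catA ep -(catA w') -wpowD -catA.
rewrite cats0 -[psi _]/[:: x] cats1 -!catA cat_cons -!nseqD.
have -> : k + (j + k.+1) = (2 * k).+1 + j by lia.
rewrite rcons_cat; exact: block_cascade.
Qed.

Lemma nf_structure_blocks : nf_structure E psi block_lang None (Some y) (3 * K0).
Proof.
have exC u v : ex (u ++ v) = ex u ++ ex v by exact: ex_cat.
have sz_psi b : 0 < size (psi b) <= size d.
  by case: b => [a|] /=; rewrite ?leqnn ?andbT //; exact: ltnW d1.
have irr_psi b : irr l (psi b) by apply: irr_small; case/andP: (sz_psi b).
split.
- by move=> b; rewrite -size_eq0 -lt0n; case/andP: (sz_psi b).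
- move=> b b' /(Euniq (irr_psi b) (irr_psi b')).
  case: b b' => [a|] [a'|] //=.
  + by case=> ->.
  + by move=> e; move: d1; rewrite -e.
  + by move=> e; move: d1; rewrite e.
- by move=> al [].
- apply: (@regular_ext _ (fun s : seq B => (s != [::]) /\ (canonical d s /\ irr l (ex s)))).
    by move=> s; split=> [[? []]|[]].
  apply: regular_and.
    by apply: regular_ext (regular_compl (@regular_nil B)) => s; split=> /eqP.
  apply: regular_and; first exact: regular_canonical.
  apply: regular_ext (regular_compl (regular_premorph psi (regular_infix l))) => s.
  by split=> /negP.
- move=> w w0; have [v iv e] := Eirr w.
  have v0 : v != [::] by apply: contra_neq w0 => v0; apply: Ene; rewrite -v0.
  exists (bparse d v); split; first exact: block_lang_parse.
  by rewrite ex_parse.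
- move=> al be [_ ca ia] [_ cb ib] /(Euniq ia ib) e.
  by rewrite -(parse_ex d0 ca) -(parse_ex d0 cb); congr bparse.
- move=> be ga [_ /canonical_catl cb]; rewrite exC => /irr_catl ib b0; by split.
- move=> b; split=> //; last by rewrite /ex /phiB /= cats0.
  move=> g b' h; have -> : g = [::].
    by case: g h => // c g /size_prefix; rewrite size_rcons.
  case: b' {h} => [a|] /=.
    by apply/negP => /size_suffix; rewrite size_map /= leqNgt d1.
  move=> j /andP[j0 lt]; apply/negP => /size_suffix.
  by rewrite size_take !size_map lt leqNgt lt.
move=> a al Lal; have [al0 ca ia] := Lal; case: a => [a|]; last first.
  by apply: block_mult_irr => //; apply: irr_cat_d.
have [sl|ns] := boolP (suffix l (rcons (ex al) a)); last first.
  by apply: block_mult_irr => //=; rewrite cats1; apply: irr_rcons.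
have [<- sd] := suffix_l_rcons sl.
have [[|m] [w [ew sw]]] := suffix_wpowP (ex al) d0.
  by rewrite ew cats0 (negPf sw) in sd.
have iw : irr l w by apply: (@irr_catl _ _ _ w (wpow d m.+1)); rewrite -ew.
exists (bparse d (w ++ x :: nseq m.+1 y)); split.
  by apply: block_lang_parse; [case: (w)|apply: irr_xy_cascade].
have [le|lt] := leqP m.+1 (2 * k); first exact: block_mult_bounded.
have em : m = 2 * k + (m - 2 * k) by lia.
by move: ew; rewrite em; apply: block_mult_long.
Qed.

End Blocks.

(** * Case distinction and conclusion *)

Definition has_nf_structure (X : finType) (E : relation (seq X)) := exists (B : finType)
  (psi : B -> seq X) (L : seq B -> Prop) (c y : B) (K : nat), nf_structure E psi L c y K.

Lemma has_nf_structure_one_relator n (E : relation (seq 'I_n)) (l : seq 'I_n) (x y : 'I_n) :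
  (forall v, E v v) -> (forall v w, E v w -> E w v) ->
  (forall v w t, E v w -> E w t -> E v t) ->
  (forall p q v w, E v w -> E (p ++ v ++ q) (p ++ w ++ q)) ->
  (forall v, E v [::] -> v = [::]) ->
  1 < size l -> E l [:: x; y] ->
  (forall v w, irr l v -> irr l w -> E v w -> v = w) ->
  (forall v, exists2 w, irr l w & E v w) ->
  ~~ suffix [:: x; y] l ->
  (2 < size l -> l != rcons (nseq (size l).-1 y) x) ->
  has_nf_structure E.
Proof.
move=> Er Es Et Ec En; case/lastP: l => // d z; rewrite size_rcons /= ltnS => sd El Eu Ei nxy nyx.
have d0 : d != [::] by case: d sd {El Eu Ei nxy nyx}.
have [zx|nzx] := eqVneq z x; last first.
  do 6 eexists; apply: nf_structure_letters_noncascade El Eu Ei nxy _ => //.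
  by move=> zx; rewrite zx eqxx in nzx.
subst z; have [d1|] := ltnP 1 (size d); last first.
  case: d sd d0 El Eu Ei nxy nyx => // c [|//] _ d0 El Eu Ei nxy _ _.
  by do 6 eexists; apply: (nf_structure_letters_single Er Et Ec En d0 El Eu Ei nxy (erefl [:: c]) erefl).
have [hx|hx] := eqVneq (head x d) x; last first.
  do 6 eexists; apply: nf_structure_blocks El Eu Ei nxy hx _ => //.
  by apply: contra_neq (nyx d1) => {1}->.
do 6 eexists; apply: nf_structure_letters_noncascade El Eu Ei nxy _ => //.
move=> _ w iw; apply/negP => /suffixP[w' ew]; move/negP: iw; apply.
(* [d] starts with [x], so [d d] contains [d x], which is [l]. *)
rewrite ew; apply/infixP; exists w', (behead d).
by rewrite -catA cat_rcons; case: (d) d0 hx => //= a s _ ->.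
Qed.

Lemma cong_swap (X : finType) (a b v w : seq X) : cong [:: (a, b)] v w -> cong [:: (b, a)] v w.
Proof.
elim=> {v w} [v w [p [q [l [r [lr [-> ->]]]]]]|v|v w _|v w t _ IH1 _ IH2].
- move: lr; rewrite inE => /eqP[-> ->]; apply/cong_ctx/cong_sym/cong_rel.
  exact: mem_head.
- exact: cong_refl.
- exact: cong_sym.
- exact: cong_trans IH1 IH2.
Qed.

Theorem theorem3p1p6 (F : fieldType) (n k : nat) (u : seq 'I_n) (x y : 'I_n) :
  (2 <= k)%N -> size u = k ->
  GS_basis F [:: orient u [:: x; y]] ->
  drop (k - 2) u != [:: x; y] ->
  u != rcons (nseq (k - 1) y) x ->
  automatic [:: (u, [:: x; y])] /\
  prefix_automatic (adjoin_one_rels [:: (u, [:: x; y])]).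
Proof.
move=> k2 uk gs last2 nyx; set R := [:: (u, [:: x; y])].
have neR s : s \in R -> s.1 != [::] /\ s.2 != [::].
  by rewrite inE => /eqP->; split=> //=; case: u uk k2 {gs last2 nyx R} => // <-.
suff [B [psi [L [c [b [K nfL]]]]]] : has_nf_structure (cong R).
  split; first by exists B, psi, L; apply: nf_structure_aut nfL.
  by apply: nf_structure_prefix_aut (nf_structure_adjoin_one neR nfL) (adjoin_one_nonempty neR).
have En v : cong R v [::] -> v = [::] by move/(cong_nonempty neR)=> [_]; apply.
have Ectx := @cong_ctx _ R; have Et := @cong_trans _ R.
have Er := @cong_refl _ R; have Es := @cong_sym _ R.
move: gs; rewrite /orient; case: ifP => [lt|nlt] gs.
  apply: (@has_nf_structure_one_relator _ _ u x y) => //.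
  - by rewrite uk.
  - by apply: cong_rel; exact: mem_head.
  - by move=> v w; apply: irr_cong_eq lt gs _ _.
  - by move=> v; apply: cong_irr lt gs _.
  - by rewrite suffixE uk.
  - by rewrite uk -subn1.
(* A word longer than [xy] would be the leading one; here [xy] leads, so [u] has two letters and
   plays the part of the right-hand side. *)
have {}k2 : k = 2.
  by apply/eqP; rewrite eqn_leq k2 andbT leqNgt -uk; apply: contraFN nlt; rewrite /deglex_lt /= => ->.
subst k; have ne : u != [:: x; y] by move: last2; rewrite k2 drop0.
have lt : deglex_lt u [:: x; y].
  by have := @deglex_total _ u [:: x; y] k2 ne; rewrite nlt orbF.
have [a [b eu]] : exists a b, u = [:: a; b].
  by case: (u) k2 => // a [|b [|//]] // _; exists a, b.
apply: (@has_nf_structure_one_relator _ _ [:: x; y] a b) => //.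
- by rewrite -eu; apply/cong_sym/cong_rel; exact: mem_head.
- by move=> v w iv iw /cong_swap; apply: irr_cong_eq lt gs _ _ iv iw.
- by move=> v; have [w iw e] := cong_irr lt gs v; exists w => //; apply: cong_swap.
- by rewrite -eu suffixE k2 drop0 eq_sym.
Qed.
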